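(* Let $\boldsymbol{u}\colon\mathbb{N}\to\mathbb{C}$ be a bounded multiplicative function such that $\frac1{b_K}\sum_{k<K}\bigl|\sum_{b_k\le n<b_{k+1}}\boldsymbol{u}(n)\bigr|\to0$ as $K\to\infty$ for every increasing sequence of integers $0=b_0<b_1<\cdots$ with $b_{k+1}-b_k\to\infty$. Let $(X,T)$ be a uniquely ergodic topological dynamical system, with unique invariant probability measure $\mu_X$, satisfying the strong MOMO property relatively to $\boldsymbol{u}$. Let $Y$ be a compact metric space and let $\bar T$ be a continuous transformation of $X\times Y$ of the form $\bar T(x,y)=(Tx,S_x(y))$. Assume that $\bar T$ is uniquely ergodic, its unique invariant measure being of the form $\mu_X\otimes\mu_Y$ for some Borel probability measure $\mu_Y$ on $Y$. Suppose that, for all large enough prime numbers $r\ne s$, the following holds: each Borel probability measure on $(X\times Y)\times(X\times Y)$ which is invariant and ergodic under $\bar T^r\times\bar T^s$ is, up to the permutation of coordinates $(x,y,x',y')\mapsto(x,x',y,y')$, of the form $\rho\otimes\mu_Y\otimes\mu_Y$, where $\rho$ is some $T^r\times T^s$-invariant probability measure on $X\times X$. Then the strong MOMO property relatively to $\boldsymbol{u}$ also holds in $(X\times Y,\bar T)$.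
   Context: $\boldsymbol{u}$ is multiplicative if $\boldsymbol{u}(1)=1$ and $\boldsymbol{u}(mn)=\boldsymbol{u}(m)\boldsymbol{u}(n)$ for coprime $m,n$; put $\boldsymbol{u}(0):=0$ in sums containing $n=0$. A topological dynamical system $(X,T)$ is a compact metric space with a continuous map $T\colon X\to X$; it is uniquely ergodic if it has exactly one invariant Borel probability measure. Strong MOMO property of $(X,T)$ relatively to $\boldsymbol{u}$: for every increasing sequence of integers $0=b_0<b_1<b_2<\cdots$ with $b_{k+1}-b_k\to\infty$, every sequence $(x_k)$ in $X$ and every $f\in C(X)$, $$\frac1{b_K}\sum_{k<K}\Bigl|\sum_{b_k\le n<b_{k+1}}f(T^{n-b_k}x_k)\boldsymbol{u}(n)\Bigr|\to0\quad (K\to\infty).$$ *)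

(* Defs.v *)
From HB Require Import structures.
From mathcomp Require Import all_boot all_order all_algebra.
From mathcomp Require Import complex.
From mathcomp Require Import all_classical all_reals all_analysis.

Set Implicit Arguments.
Unset Strict Implicit.
Unset Printing Implicit Defensive.

Import Order.TTheory GRing.Theory Num.Theory.
Import numFieldNormedType.Exports.
Import ComplexField.Normc.

Local Open Scope classical_set_scope.
Local Open Scope ring_scope.

(* Metric spaces with a distinguished point: the library's measurable spaces
   are pointed, so Borel measures need this.  The choice of point is never
   used; it only excludes the empty space, which carries no probability. *)
#[short(type="pmetricType")]
HB.structure Definition PointedMetric (K : numDomainType) :=
  { M of Metric K M & isPointed M }.

HB.instance Definition _ (X Y : ptopologicalType) :=
  Pointed.on (X * Y)%type.

Notation borel X := (g_sigma_algebraType (@open X)).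

Definition multiplicative_function (R : realType) (u : nat -> R[i]) : Prop :=
  u 1%N = 1 /\
  forall m n : nat, (0 < m)%N -> (0 < n)%N -> coprime m n ->
    u (m * n)%N = u m * u n.

Definition gap_sequence (b : nat -> nat) : Prop :=
  [/\ b 0%N = 0%N,
      (forall k, (b k < b k.+1)%N) &
      (fun k => (b k.+1 - b k)%N) @ \oo --> \oo].

Definition block_mean (R : realType) (b : nat -> nat)
    (v : nat -> nat -> R[i]) (K : nat) : R :=
  (b K)%:R^-1 * \sum_(0 <= k < K) normc (\sum_(b k <= n < b k.+1) v k n).

Definition strong_MOMO (R : realType) (X : topologicalType) (T : X -> X)
    (u : nat -> R[i]) : Prop :=
  forall b : nat -> nat, gap_sequence b ->
  forall (x : nat -> X) (f : X -> R[i]^o), continuous f ->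
    block_mean b (fun k n => f (iter (n - b k) T (x k)) * u n) @ \oo --> (0 : R).

Definition invariant_measure (R : realType) (X : ptopologicalType)
    (T : X -> X) (mu : probability (borel X) R) : Prop :=
  forall A : set (borel X), measurable A -> mu (T @^-1` A) = mu A.

Definition ergodic_measure (R : realType) (X : ptopologicalType)
    (T : X -> X) (mu : probability (borel X) R) : Prop :=
  invariant_measure T mu /\
  forall A : set (borel X), measurable A -> T @^-1` A = A ->
    mu A = 0%E \/ mu A = 1%E.

(* Measures are set functions on all subsets, so they are compared on Borel
   sets only. *)
Definition unique_invariant_measure (R : realType) (X : ptopologicalType)
    (T : X -> X) (mu : probability (borel X) R) : Prop :=
  invariant_measure T mu /\
  forall nu : probability (borel X) R, invariant_measure T nu ->
    forall A : set (borel X), measurable A -> nu A = mu A.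

Definition skew_product (X Y : Type) (T : X -> X) (S : X -> Y -> Y)
    (p : X * Y) : X * Y := (T p.1, S p.1 p.2).

Definition prod_map (X Y : Type) (f : X -> X) (g : Y -> Y)
    (p : X * Y) : X * Y := (f p.1, g p.2).

Definition permute_coord (X Y : Type) (p : (X * Y) * (X * Y)) :
    (X * X) * (Y * Y) := ((p.1.1, p.2.1), (p.1.2, p.2.2)).

(* [m1 \x m2] lives on the product of the Borel sigma-algebras; on the second
   countable spaces considered here this is the Borel sigma-algebra of the
   product space, over which the sets below range. *)
Definition is_product_measure (R : realType) (X Y : ptopologicalType)
    (lam : probability (borel (X * Y)%type) R)
    (m1 : probability (borel X) R) (m2 : probability (borel Y) R) : Prop :=
  forall A : set (borel (X * Y)%type), measurable A ->
    lam A = (m1 \x m2)%E A.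

Definition is_permuted_product (R : realType) (X Y : ptopologicalType)
    (lam : probability (borel ((X * Y) * (X * Y))%type) R)
    (rho : probability (borel (X * X)%type) R)
    (m : probability (borel Y) R) : Prop :=
  forall A : set (borel ((X * X) * (Y * Y))%type), measurable A ->
    lam (@permute_coord X Y @^-1` A) = (rho \x (m \x m))%E A.

(* Main.v *)
(** By a partition of unity on [Y] it suffices to treat real functions
    [f(x) g(y)], and splitting off [\int g] one may take [\int g dmuY = 0]: the
    remaining function of [x] alone is covered by the strong MOMO property of
    [(X, T)].

    On the block [[b_k, b_(k+1))] put [a(n) = e_k F(Tbar^(n - b_k) z_k)], where
    the phase [e_k] makes the block sum of [a u] equal to its absolute value.
    The claim becomes [sum_(n < N) a(n) u(n) = o(N)], and the Katai criterion
    reduces it to [sum_(j < N) a(r j) conj(a(s j)) = o(N)] for large primes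
    [r <> s].  Block boundaries have density zero, so this sum is, up to o(N),
    cut into windows of fixed length [L] along which it is a Birkhoff sum of
    [h(z, z') = F(z) F(z')] under [Tbar^r x Tbar^s], multiplied by a constant of
    modulus at most 1.

    Such Birkhoff averages tend to 0 uniformly: otherwise the maximum of
    [\int h] or [\int (- h)] over the invariant measures, which is attained at
    an extreme point and hence at an ergodic measure, would be positive; but
    for an ergodic measure the assumption on joinings and Fubini's theorem show
    that the integral is a multiple of [(\int g dmuY)^2 = 0]. *)

Require Import Defs.
From HB Require Import structures.
From mathcomp Require Import all_boot all_order all_algebra.
From mathcomp Require Import complex.
From mathcomp Require Import all_classical all_reals all_analysis.
From mathcomp Require Import measurable_realfun.
From mathcomp Require Import ring lra zify.
Import Order.TTheory GRing.Theory Num.Theory.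
Import numFieldNormedType.Exports.
Import ComplexField.Normc.
Set Implicit Arguments.
Unset Strict Implicit.
Unset Printing Implicit Defensive.
Local Open Scope classical_set_scope.
Local Open Scope ring_scope.

(** * Extreme points of the set of functionals below a sublinear one *)

(** The set of invariant measures is never given a topology. It is encoded by the sublinear
    functional [upper_mean] on continuous functions: the linear functionals below it are exactly the
    invariant means. One use of Zorn's lemma among sublinear functionals then yields existence,
    attainment of the maximum and extremality together, and Riesz representation is invoked only for
    the extreme functional so obtained.

    Uniformity in the starting point is the crux: the points [z_k] and the positions of the windows
    are arbitrary, so almost everywhere convergence would say nothing about them. A single good
    length [L] is enough, and it may depend on [r] and [s], since the Katai criterion treats each
    pair of primes separately and uses finitely many of them for a given precision.

    The phases are constant on blocks, so they leave a window as one factor as long as neither of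
    the times [r j], [s j] crosses a block boundary; the growth of the gaps makes the crossings
    rare. With [F] real, the conjugation touches the phases only. *)

Definition subspace_set (R : pzRingType) (V : lmodType R) (D : set V) :=
  D 0 /\ forall a x y, D x -> D y -> D (a *: x + y).

(** Homogeneity is asked as an inequality only; used for [a] and for [a^-1] it gives equality. The
    notions are relative to a subset [D] because [V] will be the module of all functions [Z -> R^o]
    and [D] the set of continuous ones. *)
Definition sublinear_on (R : realType) (V : lmodType R) (D : set V)
    (p : V -> R) :=
  (forall x y, D x -> D y -> p (x + y) <= p x + p y) /\
  (forall a x, 0 < a -> D x -> p (a *: x) <= a * p x).

Definition linear_on (R : realType) (V : lmodType R) (D : set V)
    (L : V -> R) :=
  forall a x y, D x -> D y -> L (a *: x + y) = a * L x + L y.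

Definition dominated_on (R : realType) (V : Type) (D : set V) (p q : V -> R) :=
  forall x, D x -> p x <= q x.

Lemma subspaceZ (R : pzRingType) (V : lmodType R) (D : set V) :
  subspace_set D -> forall a x, D x -> D (a *: x).
Proof. by move=> [D0 DD] a x Dx; rewrite -[_ *: _]addr0; exact: DD. Qed.

Lemma subspaceD (R : pzRingType) (V : lmodType R) (D : set V) :
  subspace_set D -> forall x y, D x -> D y -> D (x + y).
Proof. by move=> [D0 DD] x y Dx Dy; rewrite -[x]scale1r; exact: DD. Qed.

Lemma subspaceN (R : pzRingType) (V : lmodType R) (D : set V) :
  subspace_set D -> forall x, D x -> D (- x).
Proof. by move=> DD x Dx; rewrite -scaleN1r; exact: subspaceZ. Qed.

Lemma sublinear0 (R : realType) (V : lmodType R) (D : set V) (p : V -> R) :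
  subspace_set D -> sublinear_on D p -> p 0 = 0.
Proof.
move=> [D0 _] [_ pZ]; have h2 : (0 : R) < 2 by [].
have h2' : (0 : R) < 2^-1 by rewrite invr_gt0.
by have := pZ _ _ h2 D0; have := pZ _ _ h2' D0; rewrite !scaler0; lra.
Qed.

Lemma sublinearZ (R : realType) (V : lmodType R) (D : set V) (p : V -> R) :
  subspace_set D -> sublinear_on D p ->
  forall a x, 0 <= a -> D x -> p (a *: x) = a * p x.
Proof.
move=> sD sp a x; rewrite le_eqVlt => /predU1P[<- _|a0 Dx].
  by rewrite scale0r mul0r (sublinear0 sD sp).
have [_ pZ] := sp; apply/eqP; rewrite eq_le pZ//=.
have a'0 : 0 < a^-1 by rewrite invr_gt0.
have := pZ _ _ a'0 (subspaceZ sD a Dx).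
by rewrite scalerA mulVf ?gt_eqF// scale1r -(ler_pM2l a0) mulrA divff ?gt_eqF// mul1r.
Qed.

Lemma sublinearN (R : realType) (V : lmodType R) (D : set V) (p : V -> R) :
  subspace_set D -> sublinear_on D p ->
  forall x, D x -> - p (- x) <= p x.
Proof.
move=> sD sp x Dx; have := sp.1 _ _ Dx (subspaceN sD Dx).
by rewrite subrr (sublinear0 sD sp); lra.
Qed.

(* The face, in the set of linear functionals below [p], on which the value at
   [g] is maximal is the set of linear functionals below [face_sup p g]. *)
Definition face_sup (R : realType) (V : lmodType R) (p : V -> R) (g x : V) : R :=
  inf [set p (x + t *: g) - t * p g | t in [set t | 0 <= t]].

(** The functionals below [p] absorb both ends of every segment of functionals below [p0] that they
    meet in the interior. Concluding for [L1] is enough: exchanging the two ends and replacing [t]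
    by [1 - t] gives [L2]. *)
Definition face_on (R : realType) (V : lmodType R) (D : set V)
    (p0 p : V -> R) :=
  forall L1 L2 t, linear_on D L1 -> linear_on D L2 ->
    dominated_on D L1 p0 -> dominated_on D L2 p0 -> 0 < t < 1 ->
    dominated_on D (fun x => t * L1 x + (1 - t) * L2 x) p ->
    dominated_on D L1 p.

(** Writing [t *: g] as [- x + (x + t *: g)] bounds the set in the definition of [face_sup] from
    below, independently of [t], so that its infimum is meaningful. *)
Lemma face_sup_lb (R : realType) (V : lmodType R) (D : set V) (p : V -> R) g :
  subspace_set D -> sublinear_on D p -> D g ->
  forall x (t : R), D x -> 0 <= t -> - p (- x) <= p (x + t *: g) - t * p g.
Proof.
move=> sD sp Dg x t Dx t0; rewrite -(sublinearZ sD sp)//.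
have := sp.1 (- x) (x + t *: g).
rewrite addKr; have Dt := subspaceZ sD t Dg.
move=> /(_ (subspaceN sD Dx) (subspaceD sD Dx Dt)); lra.
Qed.

Lemma face_sup_le (R : realType) (V : lmodType R) (D : set V) (p : V -> R) g :
  subspace_set D -> sublinear_on D p -> D g ->
  forall x (t : R), D x -> 0 <= t -> face_sup p g x <= p (x + t *: g) - t * p g.
Proof.
move=> sD sp Dg x t Dx t0; apply: ge_inf; last by exists t.
by exists (- p (- x)) => _ [s /= s0 <-]; exact: (face_sup_lb sD).
Qed.

Lemma le_face_sup (R : realType) (V : lmodType R) (p : V -> R) g x c :
  (forall t, 0 <= t -> c <= p (x + t *: g) - t * p g) -> c <= face_sup p g x.
Proof.
move=> h; apply: lb_le_inf.
  by exists (p (x + 0 *: g) - 0 * p g); exists 0 => //=.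
by move=> _ [t /= t0 <-]; exact: h.
Qed.

Lemma face_sup_dominated (R : realType) (V : lmodType R) (D : set V)
    (p : V -> R) g : subspace_set D -> sublinear_on D p -> D g ->
  dominated_on D (face_sup p g) p.
Proof.
move=> sD sp Dg x Dx; have := face_sup_le sD sp Dg Dx (lexx 0).
by rewrite scale0r addr0 mul0r subr0.
Qed.

(** This is the parameter [t = 1]. A linear functional below [face_sup p g] is therefore at least
    [p g] at [g], that is, it attains the maximal value there. *)
Lemma face_supN (R : realType) (V : lmodType R) (D : set V) (p : V -> R) g :
  subspace_set D -> sublinear_on D p -> D g ->
  face_sup p g (- g) <= - p g.
Proof.
move=> sD sp Dg; have Ng := subspaceN sD Dg.
have := face_sup_le sD sp Dg Ng ler01.
by rewrite scale1r addNr mul1r (sublinear0 sD sp) sub0r.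
Qed.

Lemma face_sup_sublinear (R : realType) (V : lmodType R) (D : set V)
    (p : V -> R) g : subspace_set D -> sublinear_on D p -> D g ->
  sublinear_on D (face_sup p g).
Proof.
move=> sD sp Dg; split => [x y Dx Dy|a x a0 Dx].
  rewrite -lerBlDr; apply: le_face_sup => t t0.
  rewrite lerBlDr -lerBlDl; apply: le_face_sup => s s0.
  have := face_sup_le sD sp Dg
    (subspaceD sD Dx Dy) (addr_ge0 t0 s0).
  have := sp.1 (x + t *: g) (y + s *: g).
  rewrite addrACA -scalerDl => /(_ (subspaceD sD Dx (subspaceZ sD t Dg))).
  move=> /(_ (subspaceD sD Dy (subspaceZ sD s Dg))); lra.
rewrite -ler_pdivrMl//; apply: le_face_sup => t t0.
rewrite ler_pdivrMl//.
have at0 : 0 <= a * t by rewrite mulr_ge0// ltW.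
apply: (le_trans (face_sup_le sD sp Dg (subspaceZ sD a Dx) at0)).
rewrite -scalerA -scalerDr (sublinearZ sD sp); first lra.
- exact: ltW.
- by apply: subspaceD => //; exact: subspaceZ.
Qed.

(** A convex combination reaching the maximum [p g] at [g], both of whose terms are at most [p g]
    there, has both terms equal to [p g]. Then [L1 x = L1 (x + s *: g) - s * L1 g] is at most
    [p (x + s *: g) - s * p g] for every [s >= 0]. *)
Lemma face_sup_face (R : realType) (V : lmodType R) (D : set V)
    (p0 p : V -> R) g : subspace_set D -> sublinear_on D p -> D g ->
  face_on D p0 p -> face_on D p0 (face_sup p g).
Proof.
move=> sD sp Dg fp L1 L2 t l1 l2 L1p L2p /andP[t0 t1] Lp.
have sum_le : dominated_on D (fun x => t * L1 x + (1 - t) * L2 x) p.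
  by move=> x Dx; exact: le_trans (Lp _ Dx) (face_sup_dominated sD sp Dg Dx).
have d1 : dominated_on D L1 p by apply: (fp L1 L2 t) => //; rewrite t0 t1.
have d2 : dominated_on D L2 p.
  apply: (fp L2 L1 (1 - t)) => //; first by apply/andP; split; lra.
  by move=> x Dx; rewrite subKr addrC; exact: sum_le.
have D0 := sD.1.
have L10 : L1 0 = 0 by have := l1 1 0 0 D0 D0; rewrite scaler0 addr0; lra.
have L20 : L2 0 = 0 by have := l2 1 0 0 D0 D0; rewrite scaler0 addr0; lra.
have N1 : L1 (- g) = - L1 g.
  by have := l1 (-1) g 0 Dg D0; rewrite scaleN1r addr0 L10; lra.
have N2 : L2 (- g) = - L2 g.
  by have := l2 (-1) g 0 Dg D0; rewrite scaleN1r addr0 L20; lra.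
have pgL : p g <= L1 g.
  have := Lp _ (subspaceN sD Dg).
  have := face_supN sD sp Dg; have := d2 _ Dg; rewrite N1 N2.
  move=> h2 h3 h4.
  suff : t * p g <= t * L1 g by rewrite ler_pM2l.
  have : (1 - t) * L2 g <= (1 - t) * p g by apply: ler_wpM2l => //; lra.
  lra.
move=> x Dx; apply: le_face_sup => s s0.
have := d1 (s *: g + x); rewrite l1// addrC.
move=> /(_ (subspaceD sD Dx (subspaceZ sD _ Dg))).
have : s * p g <= s * L1 g by exact: ler_wpM2l.
have := d1 _ Dg; lra.
Qed.

(* Hahn-Banach and Krein-Milman at once: a sublinear functional that is minimal
   among those describing a face is linear, and the face is a single point. *)
Lemma extreme_dominated_functional (R : realType) (V : lmodType R) (D : set V)
    (p0 : V -> R) (h : V) :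
  subspace_set D -> sublinear_on D p0 -> D h ->
  exists L : V -> R, [/\ linear_on D L, dominated_on D L p0, L h = p0 h &
    forall L1 L2 t, linear_on D L1 -> linear_on D L2 ->
      dominated_on D L1 p0 -> dominated_on D L2 p0 -> 0 < t < 1 ->
      (forall x, D x -> L x = t * L1 x + (1 - t) * L2 x) ->
      forall x, D x -> L1 x = L x].
Proof.
move=> sD sp0 Dh.
(* The last clause passes to everything below [p] and forces the final linear functional to take the
   value [p0 h] at [h]. *)
pose ok p := [/\ sublinear_on D p, dominated_on D p p0,
  face_on D p0 p & p (- h) <= - p0 h].
pose T := {p : V -> R | ok p}.
(* The order is reversed: a maximal element for Zorn's lemma is a minimal functional. *)
pose below (p q : T) := `[< dominated_on D (sval q) (sval p) >].
have okh : ok (face_sup p0 h).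
  split; [exact: face_sup_sublinear|exact: face_sup_dominated| |exact: (face_supN (D := D))].
  by apply: face_sup_face => // L1 L2 t _ _ d1 _ _ _.
have step p g : ok p -> D g -> ok (face_sup p g).
  move=> [sp pp0 fp ph] Dg; split.
  - exact: face_sup_sublinear.
  - by move=> x Dx; apply: le_trans (pp0 _ Dx); exact: (face_sup_dominated (D := D)).
  - exact: face_sup_face.
  - apply: le_trans ph; apply: (face_sup_dominated (D := D)) => //.
    exact: (subspaceN (D := D)).
have [[p okp] pmax] : exists p : T, premaximal below p.
  apply: (ZL_preorder (exist _ _ okh)).
  - by move=> p; apply/asboolP => x _.
  - move=> r s t /asboolP rs /asboolP st; apply/asboolP => x Dx.
    exact: le_trans (st _ Dx) (rs _ Dx).
  move=> A totA; have [[q0 Aq0]|A0] := pselect (A !=set0); last first.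
    by exists (exist _ _ okh) => s As; case: A0; exists s.
  (* A chain is bounded by its pointwise infimum, finite because [- p0 (- x)] is a lower bound.
     Subadditivity survives since two members of the chain have a common one below them. *)
  pose E x := [set sval q x | q in A].
  pose p x := inf (E x).
  have lbE x : D x -> has_lbound (E x).
    move=> Dx; exists (- p0 (- x)) => _ [[q [sq qp0 fq qh]] Aq <-] /=.
    apply: le_trans (sublinearN sD sq Dx); rewrite lerN2.
    exact: qp0 (subspaceN sD Dx).
  have ple q x : A q -> D x -> p x <= sval q x.
    by move=> Aq Dx; apply: ge_inf; [exact: lbE|exists q].
  have lep x c : (forall q, A q -> c <= sval q x) -> c <= p x.
    move=> hc; apply: lb_le_inf; first by exists (sval q0 x), q0.
    by move=> _ [q Aq <-]; exact: hc.
  have okp : ok p.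
    split.
    - split => [x y Dx Dy|a x a0 Dx].
        rewrite -lerBlDr; apply/lep => q Aq.
        rewrite lerBlDr -lerBlDl; apply/lep => q' Aq'.
        rewrite lerBlDl.
        have [r [Ar rq rq']] : exists r, [/\ A r,
            dominated_on D (sval r) (sval q) & dominated_on D (sval r) (sval q')].
          by case: (totA _ _ Aq Aq') => /asboolP qq'; [exists q'|exists q]; split=> // z Dz.
        apply: le_trans (ple r (x + y) Ar (subspaceD sD Dx Dy)) _.
        case: (svalP r) => [[rD _] _ _ _]; apply: le_trans (rD _ _ Dx Dy) _.
        by apply: lerD; [exact: rq|exact: rq'].
      rewrite -ler_pdivrMl//; apply/lep => q Aq; rewrite ler_pdivrMl//.
      apply: le_trans (ple q (a *: x) Aq (subspaceZ sD a Dx)) _.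
      by case: (svalP q) => [[_ qZ] _ _ _]; exact: qZ.
    - move=> x Dx; apply: le_trans (ple q0 x Aq0 Dx) _.
      by case: (svalP q0) => [_ qp0 _ _]; exact: qp0.
    - move=> L1 L2 t l1 l2 d1 d2 t01 Lp x Dx; apply/lep => q Aq.
      case: (svalP q) => [_ _ fq _]; apply: (fq L1 L2 t) => // y Dy.
      exact: le_trans (Lp _ Dy) (ple _ _ Aq Dy).
    - apply: le_trans (ple q0 (- h) Aq0 (subspaceN sD Dh)) _.
      by case: (svalP q0).
  exists (exist _ p okp) => q Aq; apply/asboolP => x Dx /=; exact: ple.
have [sp pp0 fp ph] := okp.
(* Minimality of [p] against [face_sup p g] gives [p (- g) <= face_sup p g (- g) <= - p g]. A
   sublinear functional that is odd is linear. *)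
have pN g : D g -> p (- g) = - p g.
  move=> Dg; have okg := step _ _ okp Dg.
  have Ng := subspaceN sD Dg.
  have : below (exist _ p okp) (exist _ _ okg).
    by apply/asboolP => x Dx /=; exact: (face_sup_dominated (D := D)).
  move=> /pmax/asboolP/(_ _ Ng) /=; have := face_supN sD sp Dg.
  have := sublinearN sD sp Dg; lra.
have pD x y : D x -> D y -> p (x + y) = p x + p y.
  move=> Dx Dy; apply/eqP; rewrite eq_le sp.1//=.
  have := sp.1 _ _ (subspaceN sD Dx) (subspaceN sD Dy).
  by rewrite -opprD !pN//; [lra|exact: subspaceD].
have pL : linear_on D p.
  move=> a x y Dx Dy; rewrite pD//; last exact: subspaceZ.
  congr (_ + _); have [a0|a0] := leP 0 a; first exact: (sublinearZ (D := D)).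
  rewrite -[a]opprK scaleNr pN; last exact: subspaceZ.
  by rewrite (sublinearZ (D := D))// ?mulNr// oppr_ge0 ltW.
exists p; split => //.
  apply/eqP; rewrite eq_le pp0//=; move: ph; rewrite pN//; lra.
(* The face property gives [L1 <= p]; between linear functionals this is an equality, by evaluation
   at [x] and [- x]. *)
move=> L1 L2 t l1 l2 d1 d2 t01 pE x Dx.
have d x' : D x' -> L1 x' <= p x'.
  by move: x'; apply: (fp L1 L2 t) => // y Dy; rewrite pE.
apply/eqP; rewrite eq_le d//=.
have := d _ (subspaceN sD Dx); rewrite pN//.
have D0 := sD.1.
have L10 : L1 0 = 0 by have := l1 1 0 0 D0 D0; rewrite scaler0 addr0; lra.
by have := l1 (-1) x 0 Dx D0; rewrite scaleN1r addr0 L10; lra.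
Qed.

(** * Riesz representation *)

Definition mean_functional (R : realType) (Z : topologicalType)
    (L : (Z -> R) -> R) :=
  [/\ forall a (f g : Z -> R), continuous f -> continuous g ->
        L (fun z => a * f z + g z) = a * L f + L g,
      forall f : Z -> R, continuous f -> (forall z, 0 <= f z) -> 0 <= L f &
      L (fun=> 1) = 1].

(* This replaces metrizability: unlike a metric, it is at hand on products. *)
Definition cozero_opens (R : realType) (Z : topologicalType) :=
  forall U : set Z, open U -> exists phi : Z -> R,
    [/\ continuous phi, forall z, 0 <= phi z & U = [set z | 0 < phi z]].

(** Vanishing outside [U] replaces the usual condition that the support lie in [U]; the ramps
    [min (n * phi) 1] are then subordinate to the set where [phi] is positive. *)
Definition subordinate (R : realType) (Z : topologicalType) (U : set Z)
    (f : Z -> R) :=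
  [/\ continuous f, forall z, 0 <= f z <= 1 & forall z, ~ U z -> f z = 0].

Definition open_mass (R : realType) (Z : topologicalType)
    (L : (Z -> R) -> R) (U : set Z) : R :=
  sup [set L f | f in subordinate U].

Definition outer_mass (R : realType) (Z : topologicalType)
    (L : (Z -> R) -> R) (A : set Z) : R :=
  inf [set open_mass L U | U in [set U | open U /\ A `<=` U]].

Lemma continuous_min_cst (R : realType) (Z : topologicalType) (f : Z -> R) c :
  continuous f -> continuous (fun z => Num.min (f z) c).
Proof.
move=> cf z; apply: (@continuous_min R Z f (fun=> c) z); first exact: cf.
exact: cst_continuous.
Qed.

Lemma continuous_max_cst (R : realType) (Z : topologicalType) (f : Z -> R) c :
  continuous f -> continuous (fun z => Num.max (f z) c).
Proof.
move=> cf z; apply: (@continuous_max R Z f (fun=> c) z); first exact: cf.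
exact: cst_continuous.
Qed.

Lemma continuous_scale (R : realType) (Z : topologicalType) (f : Z -> R) a :
  continuous f -> continuous (fun z => a * f z).
Proof.
by move=> cf z; apply: continuousM; [exact: cst_continuous|exact: cf].
Qed.

Lemma continuous_affine (R : realType) (Z : topologicalType) (f g : Z -> R) a :
  continuous f -> continuous g -> continuous (fun z => a * f z + g z).
Proof.
move=> cf cg z; apply: (@continuousD _ _ _ (fun z => a * f z) g z).
  exact: continuous_scale.
exact: cg.
Qed.

Lemma continuous_sum_cst (R : realType) (Z : topologicalType) (f : Z -> R) c :
  continuous f -> continuous (fun z => f z + c).
Proof.
move=> cf z; apply: (@continuousD _ _ _ f (fun=> c) z); first exact: cf.
exact: cst_continuous.
Qed.

(** The compactness argument behind Dini's theorem: a condition that is open, monotone in [n] and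
    eventually true at each point holds everywhere from one [n] on. *)
Lemma compact_increasing_cover (Z : ptopologicalType) (U : nat -> set Z) :
  compact [set: Z] -> (forall n, open (U n)) ->
  (forall n m, (n <= m)%N -> U n `<=` U m) -> (forall z, exists n, U n z) ->
  exists n, forall z, U n z.
Proof.
rewrite compact_cover => cZ oU incU covU.
have [] := cZ nat setT U.
- by move=> n _; exact: oU.
- by move=> z _; have [n Uz] := covU z; exists n.
move=> F _ covF; exists (\max_(i <- finmap.enum_fset F) i)%N => z.
have [n /= nF Uz] := covF z I; apply: incU Uz.
by rewrite (big_rem n)//= leq_maxl.
Qed.

Lemma compact_continuous_bounded (R : realType) (Z : ptopologicalType)
    (f : Z -> R) :
  compact [set: Z] -> continuous f -> exists2 M, 0 < M & forall z, `|f z| <= M.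
Proof.
move=> cZ cf; have [|||n hn] := @compact_increasing_cover Z
  (fun n => [set z | `|f z| < n.+1%:R]) cZ.
- move=> n; have -> : [set z | `|f z| < n.+1%:R] =
      (fun z => `|f z|) @^-1` [set x | x < n.+1%:R :> R] by [].
  apply: open_comp; last exact: open_lt.
  by move=> z _; apply: continuous_comp; [exact: cf|exact: norm_continuous].
- by move=> n m nm z /= /lt_le_trans; apply; rewrite ler_nat.
- move=> z; exists (Num.truncn `|f z|) => /=.
  exact: truncnS_gt.
- by exists n.+1%:R => // z; exact: ltW (hn z).
Qed.

Lemma mean_le (R : realType) (Z : topologicalType) (L : (Z -> R) -> R)
    (f g : Z -> R) :
  mean_functional L -> continuous f -> continuous g ->
  (forall z, f z <= g z) -> L f <= L g.
Proof.
move=> [LL L0 _] cf cg fg; have := L0 (fun z => -1 * f z + g z).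
rewrite LL//; have h : continuous (fun z => -1 * f z + g z).
  exact: continuous_affine.
by move=> /(_ h) H; have : 0 <= -1 * L f + L g; [apply: H => z; have := fg z|]; lra.
Qed.

Lemma meanD (R : realType) (Z : topologicalType) (L : (Z -> R) -> R)
    (f g : Z -> R) :
  mean_functional L -> continuous f -> continuous g ->
  L (fun z => f z + g z) = L f + L g.
Proof.
move=> [LL _ _] cf cg; rewrite -[in RHS](mul1r (L f)) -LL//.
by congr L; apply/funext => z; rewrite mul1r.
Qed.

Lemma mean0 (R : realType) (Z : topologicalType) (L : (Z -> R) -> R) :
  mean_functional L -> L (fun=> 0) = 0.
Proof.
move=> mL; have c0 : continuous (fun _ : Z => (0 : R)) by exact: cst_continuous.
by have := meanD mL c0 c0; under eq_fun do rewrite addr0; lra.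
Qed.

Lemma meanZ (R : realType) (Z : topologicalType) (L : (Z -> R) -> R)
    (a : R) (f : Z -> R) :
  mean_functional L -> continuous f -> L (fun z => a * f z) = a * L f.
Proof.
move=> mL cf; have [LL _ _] := mL.
have c0 : continuous (fun _ : Z => (0 : R)) by exact: cst_continuous.
rewrite -[RHS]addr0 -(mean0 mL) -LL//.
by congr L; apply/funext => z; rewrite addr0.
Qed.

Lemma mean_cst (R : realType) (Z : topologicalType) (L : (Z -> R) -> R) (c : R) :
  mean_functional L -> L (fun=> c) = c.
Proof.
move=> mL; have [_ _ L1] := mL; rewrite -[RHS]mulr1 -L1 -meanZ//.
  by congr L; apply/funext => z; rewrite mulr1.
exact: cst_continuous.
Qed.

Lemma subordinate0 (R : realType) (Z : topologicalType) (U : set Z) :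
  subordinate U (fun=> 0 : R).
Proof. by split=> // [|z]; [exact: cst_continuous|rewrite lexx ler01]. Qed.

Lemma open_mass_ub (R : realType) (Z : topologicalType) (L : (Z -> R) -> R) U :
  mean_functional L -> has_ubound [set L f | f in subordinate U].
Proof.
move=> mL; exists 1 => _ [f [cf f01 _] <-]; have [_ _ <-] := mL.
apply: mean_le => //; first exact: cst_continuous.
by move=> z; case/andP: (f01 z).
Qed.

Lemma le_open_mass (R : realType) (Z : topologicalType) (L : (Z -> R) -> R) U f :
  mean_functional L -> subordinate U f -> L f <= open_mass L U.
Proof. by move=> mL sf; apply: ub_le_sup; [exact: open_mass_ub|exists f]. Qed.

Lemma open_mass_le (R : realType) (Z : topologicalType) (L : (Z -> R) -> R) U c :
  (forall f, subordinate U f -> L f <= c) -> open_mass L U <= c.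
Proof.
move=> h; apply: ge_sup; first by exists (L (fun=> 0)), (fun=> 0) => //; exact: subordinate0.
by move=> _ [f sf <-]; exact: h.
Qed.

Lemma open_mass_ge0 (R : realType) (Z : topologicalType) (L : (Z -> R) -> R) U :
  mean_functional L -> 0 <= open_mass L U.
Proof.
move=> mL; rewrite -(mean0 mL); apply: le_open_mass => //; exact: subordinate0.
Qed.

Lemma open_mass_mono (R : realType) (Z : topologicalType) (L : (Z -> R) -> R) U V :
  mean_functional L -> U `<=` V -> open_mass L U <= open_mass L V.
Proof.
move=> mL UV; apply: open_mass_le => f [cf f01 f0]; apply: le_open_mass => //.
by split => // z nV; apply: f0 => /UV.
Qed.

Lemma outer_mass_le (R : realType) (Z : topologicalType) (L : (Z -> R) -> R) U A :
  mean_functional L -> open U -> A `<=` U -> outer_mass L A <= open_mass L U.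
Proof.
move=> mL oU AU; apply: ge_inf; last by exists U.
by exists 0 => _ [V _ <-]; exact: open_mass_ge0.
Qed.

Lemma le_outer_mass (R : realType) (Z : topologicalType) (L : (Z -> R) -> R) A c :
  (forall U, open U -> A `<=` U -> c <= open_mass L U) -> c <= outer_mass L A.
Proof.
move=> h; apply: lb_le_inf.
  by exists (open_mass L setT), setT => //; split => //; exact: openT.
by move=> _ [U [oU AU] <-]; exact: h.
Qed.

Lemma outer_mass_open (R : realType) (Z : topologicalType) (L : (Z -> R) -> R) U :
  mean_functional L -> open U -> outer_mass L U = open_mass L U.
Proof.
move=> mL oU; apply/eqP; rewrite eq_le outer_mass_le//=.
by apply: le_outer_mass => V oV UV; exact: open_mass_mono.
Qed.

Lemma outer_mass_approx (R : realType) (Z : topologicalType)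
    (L : (Z -> R) -> R) A e : 0 < e ->
  exists U, [/\ open U, A `<=` U & open_mass L U < outer_mass L A + e].
Proof.
move=> e0; apply: contrapT => h.
suff : outer_mass L A + e <= outer_mass L A by lra.
apply: le_outer_mass => U oU AU; rewrite leNgt; apply/negP => lt.
by apply: h; exists U.
Qed.

Lemma open_mass_approx (R : realType) (Z : topologicalType)
    (L : (Z -> R) -> R) U (e : R) : mean_functional L -> 0 < e ->
  exists2 f, subordinate U f & open_mass L U - e < L f.
Proof.
move=> mL e0; apply: contrapT => h.
suff : open_mass L U <= open_mass L U - e by lra.
apply: open_mass_le => f sf; rewrite leNgt; apply/negP => lt.
by apply: h; exists f.
Qed.

Lemma continuous_finite_sum (R : realType) (Z : topologicalType)
    (h : nat -> Z -> R) n : (forall i, continuous (h i)) ->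
  continuous (fun z => \sum_(0 <= i < n) h i z).
Proof.
move=> ch; elim: n => [|n IH].
  by under eq_fun do rewrite big_geq//; exact: cst_continuous.
under eq_fun do rewrite big_nat_recr//=.
by move=> z; apply: continuousD; [exact: IH|exact: ch].
Qed.

Lemma mean_finite_sum (R : realType) (Z : topologicalType) (L : (Z -> R) -> R)
    (h : nat -> Z -> R) n : mean_functional L -> (forall i, continuous (h i)) ->
  L (fun z => \sum_(0 <= i < n) h i z) = \sum_(0 <= i < n) L (h i).
Proof.
move=> mL ch; elim: n => [|n IH].
  by rewrite big_geq//; under eq_fun do rewrite big_geq//; exact: mean0.
under eq_fun do rewrite big_nat_recr//=.
by rewrite big_nat_recr//= meanD// ?IH//; exact: continuous_finite_sum.
Qed.

Lemma subordinate_ramp (R : realType) (Z : topologicalType) (phi : Z -> R)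
    (n : nat) : continuous phi -> (forall z, 0 <= phi z) ->
  subordinate [set z | 0 < phi z] (fun z => Num.min (n%:R * phi z) 1).
Proof.
move=> cphi phi0; split.
- by apply: continuous_min_cst; exact: continuous_scale.
- by move=> z; rewrite ge_min lexx orbT le_min ler01 mulr_ge0.
- move=> z /negP; rewrite -leNgt => phi_le.
  have -> : phi z = 0 by apply/eqP; rewrite eq_le phi_le phi0.
  by rewrite mulr0 min_l.
Qed.

Lemma open_preimage_lt (R : realType) (Z : topologicalType) (f : Z -> R) c :
  continuous f -> open [set z | f z < c].
Proof.
move=> cf; have -> : [set z | f z < c] = f @^-1` [set x | x < c] by [].
by apply: open_comp; [move=> z _; exact: cf|exact: open_lt].
Qed.

(** Finite sums of ramps subordinate to the [U i] eventually exceed [f - e] at each point, hence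
    uniformly by compactness; applying [L] turns this into the bound on masses. *)
Lemma open_mass_bigcup (R : realType) (Z : ptopologicalType)
    (L : (Z -> R) -> R) (U : nat -> set Z) f (e : R) :
  compact [set: Z] -> cozero_opens R Z -> mean_functional L ->
  (forall i, open (U i)) -> 0 < e -> subordinate (\bigcup_i U i) f ->
  exists n, L f <= \sum_(0 <= i < n) open_mass L (U i) + e.
Proof.
move=> cZ zZ mL oU e0 [cf f01 f0].
have /choice[phi phiP] i := zZ _ (oU i).
have cphi i : continuous (phi i) by case: (phiP i).
have phi0 i z : 0 <= phi i z by case: (phiP i).
(* The same [n] is the slope of the ramps and the number of summands in [g n], so that [g] increases
   with [n]. *)
pose h (n i : nat) z : R := Num.min (n%:R * phi i z) 1.
have sh n i : subordinate (U i) (h n i).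
  by have [_ _ ->] := phiP i; exact: subordinate_ramp.
have ch n i : continuous (h n i) by case: (sh n i).
pose g n z := \sum_(0 <= i < n) h n i z.
have cg n : continuous (g n) by exact: continuous_finite_sum.
have [|||n hn] := @compact_increasing_cover Z
    (fun n => [set z | -1 * g n z + f z < e]) cZ.
- by move=> n; apply: open_preimage_lt; exact: continuous_affine.
- move=> n m nm z /=; suff : g n z <= g m z by lra.
  rewrite /g (@big_cat_nat _ _ _ n 0 m)//= -[leLHS]addr0; apply: lerD.
    apply: ler_sum => i _; rewrite /h le_min ge_min [X in _ && X]ge_min lexx orbT andbT.
    by rewrite ler_wpM2r// ler_nat.
  by apply: sumr_ge0 => i _; have [_ /(_ z)/andP[]] := sh m i.
- move=> z; have [[i _ Uz]|nU] := pselect ((\bigcup_i U i) z); last first.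
    by exists 0%N; rewrite /= /g big_geq//= f0//; lra.
  have phiz : 0 < phi i z by move: Uz; have [_ _ ->] := phiP i.
  (* The first entry puts the index [i] into the sum, the second saturates its ramp at [z]. *)
  pose n := maxn i.+1 (Num.truncn (phi i z)^-1).+1; exists n.
  have h1 : h n i z = 1.
    apply: min_r; rewrite -ler_pdivrMr// div1r; apply: ltW.
    apply: lt_le_trans (truncnS_gt _) _; by rewrite ler_nat leq_maxr.
  have : 1 <= g n z; last by have /andP[_ ?] := f01 z => /=; lra.
  rewrite /g (@big_cat_nat _ _ _ i 0 n)//=; last first.
    by apply: leq_trans (leq_maxl _ _); exact: leqnSn.
  rewrite (@big_ltn _ _ _ i) ?leq_max ?leqnn// h1 addrCA lerDl addr_ge0//.
    by apply: sumr_ge0 => j _; have [_ /(_ z)/andP[]] := sh n j.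
  by apply: sumr_ge0 => j _; have [_ /(_ z)/andP[]] := sh n j.
exists n; apply: (@le_trans _ _ (L (fun z => g n z + e))).
  apply: mean_le => //; first exact: continuous_sum_cst.
  by move=> z; have := hn z => /=; lra.
rewrite meanD//; last exact: cst_continuous.
rewrite mean_cst// lerD2r mean_finite_sum//.
by apply: ler_sum => i _; exact: le_open_mass.
Qed.

Lemma geometric_partial_sum_le (R : realType) (e : R) n : 0 < e ->
  \sum_(0 <= i < n) e / 2 ^+ i.+1 <= e.
Proof.
move=> e0; suff -> : \sum_(0 <= i < n) e / 2 ^+ i.+1 = e - e / 2 ^+ n.
  by rewrite gerBl divr_ge0 ?exprn_ge0// ltW.
elim: n => [|n IH]; first by rewrite big_geq// expr0 divr1 subrr.
rewrite big_nat_recr//= IH exprS; field.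
by rewrite expf_neq0.
Qed.

Lemma outer_mass_sigma_subadditive (R : realType) (Z : ptopologicalType)
    (L : (Z -> R) -> R) :
  compact [set: Z] -> cozero_opens R Z -> mean_functional L ->
  sigma_subadditive (fun A => (outer_mass L A)%:E).
Proof.
move=> cZ zZ mL A; apply/lee_addgt0Pr => e e0.
(* One third each for the choice of the [U i], for the function that nearly realises the mass of
   their union, and for the passage to finitely many of them. *)
have e3 : 0 < e / 3 by rewrite divr_gt0.
have /choice[U UP] (i : nat) : exists U, [/\ open U, A i `<=` U &
    open_mass L U < outer_mass L (A i) + e / 3 / 2 ^+ i.+1].
  by apply: outer_mass_approx; rewrite divr_gt0// exprn_gt0.
have oU i : open (U i) by case: (UP i).
have [f sf Lf] := @open_mass_approx _ _ L (\bigcup_i U i) _ mL e3.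
have [n fn] := open_mass_bigcup cZ zZ mL oU e3 sf.
have AU : outer_mass L (\bigcup_i A i) <= open_mass L (\bigcup_i U i).
  apply: outer_mass_le => //; first exact: bigcup_open.
  by apply: subset_bigcup => i _; case: (UP i).
have Un : \sum_(0 <= i < n) open_mass L (U i) <=
    \sum_(0 <= i < n) outer_mass L (A i) + e / 3.
  apply: le_trans (lerD (lexx _) (geometric_partial_sum_le n e3)).
  rewrite -big_split /=; apply: ler_sum => i _; have [_ _] := UP i; exact: ltW.
apply: (@le_trans _ _ (\sum_(0 <= i < n) (outer_mass L (A i))%:E + e%:E)%E).
  rewrite sumEFin -EFinD lee_fin; lra.
rewrite leeD2r//; apply: nneseries_lim_ge => i _ _.
by rewrite lee_fin; apply: le_outer_mass => V _ _; exact: open_mass_ge0.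
Qed.

(** The Caratheodory condition for open sets. Take [f] nearly realising the mass of [U] inside [V].
    The part of [X] outside [U] lies in [W], where [f < e], so a function [g] nearly realising the
    mass of [W] can be added to the positive part of [f - e] without exceeding 1. *)
Lemma outer_mass_split_open (R : realType) (Z : topologicalType)
    (L : (Z -> R) -> R) (U X : set Z) : mean_functional L -> open U ->
  outer_mass L (X `&` U) + outer_mass L (X `&` ~` U) <= outer_mass L X.
Proof.
move=> mL oU; apply/ler_addgt0Pr => e' e'0.
(* Four losses of [e]: the choices of [V], [f] and [g], and the lowering of [f] by [e]. *)
pose e := e' / 4; have e0 : 0 < e by rewrite divr_gt0.
have [V [oV XV mV]] := @outer_mass_approx _ _ L X e e0.
have [f [cf f01 f0] Lf] := @open_mass_approx _ _ L (U `&` V) _ mL e0.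
pose W := V `&` [set z | f z < e].
have oW : open W by apply: openI => //; exact: open_preimage_lt.
have [g [cg g01 g0] Lg] := @open_mass_approx _ _ L W _ mL e0.
pose f' z := Num.max (f z + - e) 0.
have cf' : continuous f' by apply: continuous_max_cst; exact: continuous_sum_cst.
have Lf' : L f - e <= L f'.
  have := @mean_le _ _ L (fun z => f z + - e) f' mL.
  rewrite meanD ?mean_cst//; last exact: cst_continuous.
  by apply=> // [|z]; [exact: continuous_sum_cst|rewrite /f' le_max lexx].
have sV : subordinate V (fun z => f' z + g z).
  split=> [z|z|z nVz].
  - by apply: continuousD; [exact: cf'|exact: cg].
  - have := f01 z; have := g01 z; rewrite /f'.
    have [fe|fe] := ltP (f z) e.
      by rewrite max_r ?add0r//; lra.
    by rewrite g0 ?max_l; [lra|lra|move=> [_ /=]; lra].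
  - have gz : g z = 0 by apply: g0; case.
    have fz : f z = 0 by apply: f0; case.
    by rewrite gz addr0 /f' fz max_r//; lra.
have VL := le_open_mass mL sV.
rewrite meanD// in VL.
have h1 : outer_mass L (X `&` U) <= open_mass L (U `&` V).
  apply: outer_mass_le => //; first exact: openI.
  by move=> z [Xz Uz]; split => //; exact: XV.
have h2 : outer_mass L (X `&` ~` U) <= open_mass L W.
  apply: outer_mass_le => // z [Xz Uz]; split; first exact: XV.
  by rewrite /= f0//; case.
have : e' = e * 4 by rewrite /e divfK.
lra.
Qed.

Lemma open_borel (Z : ptopologicalType) (U : set Z) :
  open U -> measurable (U : set (borel Z)).
Proof. by move=> oU; exact: sub_sigma_algebra. Qed.

Lemma continuous_borel (R : realType) (Z : ptopologicalType) (f : Z -> R) :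
  continuous f -> measurable_fun setT (f : borel Z -> R).
Proof.
move=> /continuousP cf.
apply: (measurability _ (measurable_realfun.RGenOpens.measurableE R)).
move=> _ [_ [a [b ->] <-]]; rewrite setTI; apply: open_borel.
exact/cf/interval_open.
Qed.

Lemma continuous_borel_map (Z Z' : ptopologicalType) (f : Z -> Z') :
  continuous f -> measurable_fun setT (f : borel Z -> borel Z').
Proof.
move=> /continuousP cf; apply: (@measurability _ _ (borel Z) (borel Z') _ _ (@open Z')) => //.
by move=> _ [U oU <-]; rewrite setTI; apply: open_borel; exact: cf.
Qed.

Lemma continuous_integrable (R : realType) (Z : ptopologicalType)
    (mu : {finite_measure set (borel Z) -> \bar R}) (f : Z -> R) :
  compact [set: Z] -> continuous f -> mu.-integrable setT (EFin \o f).
Proof.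
move=> cZ cf; apply: measurable_bounded_integrable => //.
- by rewrite ltey_eq fin_num_measure.
- exact: continuous_borel.
have [M M0 hM] := compact_continuous_bounded cZ cf.
by exists M; split; [exact: num_real|move=> y My z _ /=; apply: le_trans (hM z) (ltW My)].
Qed.

Lemma riesz_open_measure (R : realType) (Z : ptopologicalType)
    (L : (Z -> R) -> R) :
  compact [set: Z] -> cozero_opens R Z -> mean_functional L ->
  exists mu : probability (borel Z) R,
    forall U, open U -> mu U = (open_mass L U)%:E.
Proof.
move=> cZ zZ mL.
pose m (A : set Z) := (outer_mass L A)%:E.
have m_ge0 A : (0 <= m A)%E.
  by rewrite lee_fin; apply: le_outer_mass => U _ _; exact: open_mass_ge0.
have m0 : m set0 = 0%E.
  apply/eqP; rewrite eq_le m_ge0 andbT.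
  rewrite lee_fin outer_mass_open//; last exact: open0.
  apply: open_mass_le => f [_ _ f0]; rewrite -[leRHS](mean0 mL).
  suff -> : f = fun=> 0 by [].
  by apply/funext => z; rewrite f0.
have m_le : {homo m : A B / A `<=` B >-> (A <= B)%E}.
  move=> A B AB; rewrite lee_fin; apply: le_outer_mass => U oU BU.
  by apply: outer_mass_le => //; exact: subset_trans BU.
have m_sub := outer_mass_sigma_subadditive cZ zZ mL.
pose mo : {outer_measure set Z -> \bar R} :=
  HB.pack m (isOuterMeasure.Build R Z m m0 m_ge0 m_le m_sub).
have bcar : (measurable : set (set (borel Z))) `<=`
    (measurable : set (set (caratheodory_type mo))).
  apply: smallest_sub; first exact: sigma_algebra_measurable.
  move=> U oU; apply: le_caratheodory_measurable => X.
  by rewrite -EFinD lee_fin; exact: outer_mass_split_open.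
pose mb : set (borel Z) -> \bar R := m.
have mb_add : semi_sigma_additive mb.
  move=> F mF tF mUF.
  apply: (@caratheodory_measure_sigma_additive R Z mo F) => //.
    by move=> i; apply: bcar; exact: mF.
  exact: bcar.
pose mb_meas := isMeasure.Build _ _ _ mb m0 m_ge0 mb_add.
pose mm : {measure set (borel Z) -> \bar R} := HB.pack mb mb_meas.
have mT : mm setT = 1%E.
  rewrite /mm /= /mb /m outer_mass_open//; last exact: openT.
  congr EFin; apply/eqP; rewrite eq_le; apply/andP; split.
    apply: open_mass_le => f [cf f01 _]; rewrite -[leRHS](mean_cst 1 mL).
    by apply: mean_le => //; [exact: cst_continuous|move=> z; case/andP: (f01 z)].
  rewrite -[leLHS](mean_cst 1 mL); apply: le_open_mass => //.
  by split=> [|z|z /(_ I)//]; [exact: cst_continuous|rewrite lexx ler01].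
pose mp : probability (borel Z) R :=
  HB.pack mb mb_meas (Measure_isProbability.Build _ _ _ mm mT).
exists mp => U oU; rewrite /mp /= /mb /m outer_mass_open//.
Qed.

(** The inequality [L f <= \int f] for [f] with values in [[0, 1]] is enough: applied to [1 - f] as
    well it gives equality, and an arbitrary [f] is an affine image of such a function. *)
Theorem riesz_representation (R : realType) (Z : ptopologicalType)
    (L : (Z -> R) -> R) :
  compact [set: Z] -> cozero_opens R Z -> mean_functional L ->
  exists mu : probability (borel Z) R,
    forall f : Z -> R, continuous f -> \int[mu]_z f z = L f.
Proof.
move=> cZ zZ mL; have [mu muE] := riesz_open_measure cZ zZ mL.
exists mu; have muT : fine (mu setT) = 1 by rewrite (@probability_setT _ _ _ mu).
have int (f : Z -> R) : continuous f -> mu.-integrable setT (EFin \o f).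
  exact: continuous_integrable.
(* [f] is peeled off in layers of height [d]: [f = max(f - d, 0) + min(f, d)],
   where [L (min f d) <= d * mass(f > 0)] and [d * mass(f > d) <= \int min f d]. *)
have layer (d : R) n : 0 < d -> forall f : Z -> R, continuous f ->
    (forall z, 0 <= f z <= n%:R * d) ->
    L f <= \int[mu]_z f z + d * open_mass L [set z | 0 < f z].
  move=> d0; elim: n => [|n IH] f cf f0n.
    have -> : f = fun=> 0.
      by apply/funext => z; have := f0n z; rewrite mul0r -eq_le => /eqP.
    rewrite mean0// addr_ge0//; first exact: Rintegral_ge0.
    by rewrite mulr_ge0 ?open_mass_ge0// ltW.
  pose f1 z := Num.max (f z + - d) 0.
  pose f2 z := Num.min (f z) d.
  have cf1 : continuous f1 by apply: continuous_max_cst; exact: continuous_sum_cst.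
  have cf2 : continuous f2 by exact: continuous_min_cst.
  have fE z : f z = f1 z + f2 z.
    rewrite /f1 /f2; have [fd|fd] := leP (f z) d.
      by rewrite max_r ?add0r//; lra.
    by rewrite max_l; lra.
  have Lf1 : L f1 <= \int[mu]_z f1 z + d * open_mass L [set z | 0 < f1 z].
    apply: IH => // z; rewrite /f1 le_max lexx orbT ge_max mulr_ge0 ?(ltW d0)// andbT.
    by have /andP[_] := f0n z; rewrite -natr1 mulrDl mul1r; lra.
  have Lf2 : L f2 <= d * open_mass L [set z | 0 < f z].
    rewrite -ler_pdivrMl// -meanZ//; apply: le_open_mass => //; split.
    - exact: continuous_scale.
    - move=> z; have /andP[fz0 _] := f0n z.
      rewrite mulr_ge0 ?invr_ge0 ?(ltW d0)//=; last by rewrite le_min fz0 ltW.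
      by rewrite ler_pdivrMl// mulr1 ge_min lexx orbT.
    - move=> z /= /negP; rewrite -leNgt => fz; have /andP[fz0 _] := f0n z.
      have -> : f2 z = 0 by rewrite /f2 min_l; lra.
      by rewrite mulr0.
  have mf1 : d * open_mass L [set z | 0 < f1 z] <= \int[mu]_z f2 z.
    have oU : open [set z | 0 < f1 z].
      have -> : [set z | 0 < f1 z] = f1 @^-1` [set x | 0 < x] by [].
      by apply: open_comp; [move=> z _; exact: cf1|exact: open_gt].
    have -> : open_mass L [set z | 0 < f1 z] = fine (mu [set z | 0 < f1 z]).
      by rewrite muE.
    rewrite -(Rintegral_cst mu (open_borel oU)) Rintegral_mkcond.
    apply: le_Rintegral => //; last first.
    - move=> z _; rewrite patchE; case: ifPn => [|_].
        by rewrite inE /f1 /f2 /= lt_max ltxx orbF => fz; rewrite le_min lexx andbT; lra.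
      by rewrite le_min (ltW d0) andbT; case/andP: (f0n z).
    - exact: int.
    - rewrite -restrict_EFin; apply/integrable_restrict => //.
        exact: open_borel.
      rewrite setTI; apply: (integrableS (E := setT)) => //; first exact: open_borel.
      by apply: (int (fun=> d)); exact: cst_continuous.
  have -> : f = (fun z => f1 z + f2 z) by apply/funext.
  rewrite meanD// RintegralD//; [|exact: int|exact: int].
  have -> : [set z | 0 < f1 z + f2 z] = [set z | 0 < f z].
    by apply/seteqP; split=> z /=; rewrite -fE.
  lra.
have le01 (f : Z -> R) : continuous f -> (forall z, 0 <= f z <= 1) -> L f <= \int[mu]_z f z.
  move=> cf f01; apply/ler_addgt0Pr => e e0.
  (* With [n] layers of height [1 / n] the error is [1 / n] times a mass that is at most 1. *)
  pose n := (Num.truncn e^-1).+1.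
  have n0 : (0 : R) < n%:R by rewrite ltr0n.
  apply: (le_trans (layer n%:R^-1 n _ f cf _)).
  - by rewrite invr_gt0.
  - by move=> z; rewrite mulfV ?gt_eqF.
  rewrite lerD2l; apply: (@le_trans _ _ (n%:R^-1 * 1)).
    rewrite ler_pM2l ?invr_gt0//; apply: open_mass_le => g [cg g01 _].
    rewrite -[leRHS](mean_cst 1 mL).
    by apply: mean_le => //; [exact: cst_continuous|move=> z; case/andP: (g01 z)].
  rewrite mulr1 invf_ple ?posrE//; apply: ltW; exact: truncnS_gt.
have eq01 (f : Z -> R) : continuous f -> (forall z, 0 <= f z <= 1) -> L f = \int[mu]_z f z.
  move=> cf f01; apply/eqP; rewrite eq_le le01//=.
  have [LL _ L1] := mL.
  have c1 : continuous (fun _ : Z => (1 : R)) by exact: cst_continuous.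
  have cg : continuous (fun z => -1 * f z + 1) by exact: continuous_affine.
  have := le01 _ cg; rewrite LL// L1 RintegralD//; last 2 first.
  - by apply: int; exact: continuous_scale.
  - exact: int.
  rewrite RintegralZl//; last exact: int.
  rewrite Rintegral_cst// muT.
  by move=> H; suff : -1 * L f + 1 <= -1 * \int[mu]_x f x + 1 * 1; [lra|];
    apply: H => z; have := f01 z; lra.
move=> f cf; have [M M0 fM] := compact_continuous_bounded cZ cf.
have cM : continuous (fun _ : Z => M) by exact: cst_continuous.
pose g z := (2 * M)^-1 * (f z + M).
have cg : continuous g by apply: continuous_scale; exact: continuous_sum_cst.
have M2 : 0 < 2 * M by rewrite mulr_gt0.
have fE : f = fun z => 2 * M * g z + - M.
  by apply/funext => z; rewrite /g mulrA divff ?gt_eqF// mul1r addrK.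
have ig := int _ cg.
have cNM : continuous (fun _ : Z => - M) by exact: cst_continuous.
rewrite fE RintegralD//; last 2 first.
- by apply: int; exact: continuous_scale.
- exact: int.
rewrite RintegralZl// Rintegral_cst// muT mulr1.
have [LL _ _] := mL; rewrite LL// mean_cst//; congr (_ * _ + _).
rewrite -eq01// => z; have := fM z; rewrite ler_norml => /andP[? ?].
rewrite /g ler_pdivlMl// ler_pdivrMl//; lra.
Qed.

(** * Uniform Birkhoff averages and ergodic measures *)

(** Monotone convergence of the ramps to an indicator. It carries identities between integrals of
    continuous functions over to the measures of open sets, which determine a finite Borel
    measure. *)
Lemma ramp_integral_cvg (R : realType) (Z : ptopologicalType)
    (mu : {measure set (borel Z) -> \bar R}) (D : set (borel Z))
    (phi : Z -> R) :
  measurable D -> continuous phi -> (forall z, 0 <= phi z) ->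
  (\int[mu]_(z in D) (Num.min (n%:R * phi z) 1)%:E)%E @[n --> \oo] -->
    mu ([set z | 0 < phi z] `&` D).
Proof.
move=> mD cphi phi0.
have sub n := @subordinate_ramp _ _ phi n cphi phi0.
have oU : open [set z | 0 < phi z].
  have -> : [set z | 0 < phi z] = phi @^-1` [set x | 0 < x] by [].
  by apply: open_comp; [move=> z _; exact: cphi|exact: open_gt].
rewrite -(integral_indic mu mD (open_borel oU)).
have := @cvg_monotone_convergence _ _ _ mu D mD
  (fun n z => (Num.min (n%:R * phi z) 1)%:E) _ _ _.
have limE z : limn (fun n => (Num.min (n%:R * phi z) 1)%:E) =
    (\1_[set z | 0 < phi z] z)%:E :> \bar R.
  rewrite indicE; have [phiz|phiz] := ltP 0 (phi z); last first.
    have phz : phi z = 0 by apply/eqP; rewrite eq_le phi0 phiz.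
    rewrite memNset /=; last by rewrite phz ltxx.
    under eq_fun do rewrite phz mulr0 min_l//.
    by rewrite lim_cst.
  rewrite mem_set//; apply/cvg_lim => //.
  apply: cvg_near_cst; near=> n; congr EFin; apply: min_r.
  rewrite -ler_pdivrMr// div1r; near: n.
  exists (Num.truncn (phi z)^-1).+1 => // n /= hn.
  by apply: ltW; apply: lt_le_trans (truncnS_gt _) _; rewrite ler_nat.
under eq_integral do rewrite limE.
apply.
- move=> n; apply/measurable_EFinP; apply: measurable_funTS; apply: continuous_borel.
  by case: (sub n).
- by move=> n z _; rewrite lee_fin; have [_ /(_ z)/andP[]] := sub n.
- move=> z _ n m nm; rewrite lee_fin le_min ge_min [X in _ && X]ge_min lexx orbT andbT.
  by rewrite ler_wpM2r// ler_nat.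
Unshelve. all: by end_near. Qed.

Lemma borel_measure_unique (R : realType) (Z : ptopologicalType)
    (m1 m2 : {measure set (borel Z) -> \bar R}) :
  (m1 setT < +oo)%E -> (forall U : set Z, open U -> m1 U = m2 U) ->
  forall A : set (borel Z), measurable A -> m1 A = m2 A.
Proof.
move=> m1T m12.
apply: (@g_sigma_algebra_measure_unique _ R (borel Z) (@open Z) _ (fun=> setT)) => //.
- by move=> U oU; exact: open_borel.
- by move=> _; exact: openT.
- by apply/seteqP; split=> // z _; exists 0%N.
- by move=> A B; exact: openI.
Qed.

Definition orbit_sum (R : realType) (Z : Type) (S : Z -> Z) (h : Z -> R)
    (n : nat) (z : Z) : R :=
  \sum_(0 <= j < n) h (iter j S z).

(* The maximum of the integral of [h] over the [S]-invariant probabilities. *)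
Definition upper_mean (R : realType) (Z : Type) (S : Z -> Z) (h : Z -> R) : R :=
  inf [set c | exists2 n, (0 < n)%N & forall z, orbit_sum S h n z <= n%:R * c].

Lemma orbit_sumM (R : realType) (Z : Type) (S : Z -> Z) (h : Z -> R) n m z :
  orbit_sum S h (n * m) z =
  \sum_(0 <= i < m) orbit_sum S h n (iter (i * n) S z).
Proof.
elim: m => [|m IH]; first by rewrite muln0 /orbit_sum !big_geq.
rewrite big_nat_recr//= -IH mulnS addnC /orbit_sum.
rewrite (@big_cat_nat _ _ _ (n * m) 0 (n * m + n))//= ?leq_addr//; congr (_ + _).
rewrite -{1}[(n * m)%N]add0n big_addn addKn; apply: eq_bigr => j _.
by rewrite iterD mulnC.
Qed.

(** Bounds found at two different lengths are compared at the product of the lengths. *)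
Lemma orbit_sum_leM (R : realType) (Z : Type) (S : Z -> Z) (h : Z -> R) n m c :
  (forall z, orbit_sum S h n z <= n%:R * c) ->
  forall z, orbit_sum S h (n * m) z <= (n * m)%:R * c.
Proof.
move=> hc z; rewrite orbit_sumM.
apply: (@le_trans _ _ (\sum_(0 <= i < m) n%:R * c)).
  by apply: ler_sum => i _; exact: hc.
by rewrite sumr_const_nat subn0 -[leLHS]mulr_natr natrM mulrAC.
Qed.

Lemma orbit_sumD (R : realType) (Z : Type) (S : Z -> Z) (f g : Z -> R) n z :
  orbit_sum S (fun x => f x + g x) n z = orbit_sum S f n z + orbit_sum S g n z.
Proof. by rewrite /orbit_sum big_split. Qed.

Lemma orbit_sum_le (R : realType) (Z : Type) (S : Z -> Z) (f g : Z -> R) n z :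
  (forall x, f x <= g x) -> orbit_sum S f n z <= orbit_sum S g n z.
Proof. by move=> fg; apply: ler_sum => i _. Qed.

Lemma orbit_sum_cst (R : realType) (Z : Type) (S : Z -> Z) (c : R) n z :
  orbit_sum S (fun=> c) n z = n%:R * c.
Proof. by rewrite /orbit_sum sumr_const_nat subn0 mulr_natl. Qed.

Lemma upper_mean_le (R : realType) (Z : ptopologicalType) (S : Z -> Z)
    (h : Z -> R) n c :
  compact [set: Z] -> continuous h -> (0 < n)%N ->
  (forall z, orbit_sum S h n z <= n%:R * c) -> upper_mean S h <= c.
Proof.
move=> cZ ch n0 hc; apply: ge_inf; last by exists n.
have [M M0 hM] := compact_continuous_bounded cZ ch.
exists (- M) => d [m m0 hd]; rewrite -(@ler_pM2l _ m%:R) ?ltr0n//.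
apply: le_trans (hd point); rewrite -(orbit_sum_cst S _ m point).
by apply: orbit_sum_le => z; have := hM z; rewrite ler_norml => /andP[].
Qed.

Lemma le_upper_mean (R : realType) (Z : ptopologicalType) (S : Z -> Z)
    (h : Z -> R) d :
  compact [set: Z] -> continuous h ->
  (forall n c, (0 < n)%N -> (forall z, orbit_sum S h n z <= n%:R * c) -> d <= c) ->
  d <= upper_mean S h.
Proof.
move=> cZ ch hd; apply: lb_le_inf; last by move=> c [n n0 hc]; exact: hd hc.
have [M M0 hM] := compact_continuous_bounded cZ ch.
exists M, 1%N => // z; rewrite /orbit_sum big_nat1 mul1r.
by have := hM z; rewrite ler_norml => /andP[].
Qed.

Lemma upper_mean_approx (R : realType) (Z : ptopologicalType) (S : Z -> Z)
    (h : Z -> R) (e : R) :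
  compact [set: Z] -> continuous h -> 0 < e ->
  exists2 n, (0 < n)%N &
    forall z, orbit_sum S h n z <= n%:R * (upper_mean S h + e).
Proof.
move=> cZ ch e0; apply: contrapT => hn.
suff : upper_mean S h + e <= upper_mean S h by lra.
apply: le_upper_mean => // n c n0 hc; rewrite leNgt; apply/negP => ce.
apply: hn; exists n => // z; apply: le_trans (hc z) _.
by rewrite ler_wpM2l// ltW.
Qed.

Lemma upper_mean_sublinear (R : realType) (Z : ptopologicalType) (S : Z -> Z) :
  compact [set: Z] ->
  sublinear_on [set f : Z -> R^o | continuous f] (upper_mean S).
Proof.
move=> cZ; split => [f g /= cf cg|a f a0 /= cf].
  have cfg : continuous (f + g) by move=> z; apply: continuousD; [exact: cf|exact: cg].
  rewrite -lerBlDr; apply: le_upper_mean => // n c n0 hc.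
  rewrite lerBlDr -lerBlDl; apply: le_upper_mean => // m d m0 hd.
  rewrite lerBlDl; apply: (@upper_mean_le _ _ S (f + g) (n * m)%N) => //.
    by rewrite muln_gt0 n0.
  move=> z; rewrite -[f + g]/(fun x => f x + g x) mulrDr orbit_sumD.
  apply: lerD; first exact: orbit_sum_leM.
  by rewrite mulnC; exact: orbit_sum_leM.
rewrite -ler_pdivrMl//; apply: le_upper_mean => // n c n0 hc.
rewrite ler_pdivrMl//; apply: (@upper_mean_le _ _ S (a *: f) n) => //.
  exact: continuous_scale.
move=> z; have -> : orbit_sum S (a *: f) n z = a * orbit_sum S f n z.
  by rewrite /orbit_sum mulr_sumr.
by rewrite [leRHS]mulrCA; apply: ler_wpM2l; [exact: ltW|exact: hc].
Qed.

Lemma continuous_iter (Z : topologicalType) (S : Z -> Z) n :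
  continuous S -> continuous (iter n S).
Proof.
move=> cS; elim: n => [|n IH] z; first exact: cvg_id.
by apply: continuous_comp; [exact: IH|exact: cS].
Qed.

Definition invariant_functional (R : realType) (Z : topologicalType)
    (S : Z -> Z) (L : (Z -> R) -> R) :=
  forall f : Z -> R, continuous f -> L (f \o S) = L f.

Lemma invariant_functional_dominated (R : realType) (Z : ptopologicalType)
    (S : Z -> Z) (L : (Z -> R) -> R) :
  compact [set: Z] -> continuous S ->
  mean_functional L -> invariant_functional S L ->
  forall f : Z -> R, continuous f -> L f <= upper_mean S f.
Proof.
move=> cZ cS mL iL f cf; apply: le_upper_mean => // n c n0 hc.
have cfS i : continuous (fun z => f (iter i S z)).
  by move=> z; apply: continuous_comp; [exact: continuous_iter|exact: cf].
have LS i : L (fun z => f (iter i S z)) = L f.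
  elim: i => [|i IH] //; rewrite -{}IH -[RHS]iL//.
  by congr L; apply/funext => z /=; rewrite -iterSr.
have : L (orbit_sum S f n) <= n%:R * c.
  rewrite -[leRHS](mean_cst (n%:R * c) mL); apply: mean_le => //.
    exact: continuous_finite_sum.
  exact: cst_continuous.
rewrite mean_finite_sum//; under eq_bigr do rewrite LS.
by rewrite sumr_const_nat subn0 -[leLHS]mulr_natl ler_pM2l// ltr0n.
Qed.

(** Length 1 in [upper_mean] bounds [L f] by any upper bound of [f], whence positivity and
    [L 1 = 1]. Invariance comes from telescoping: the orbit sums of [f \o S - f] and of its opposite
    stay bounded, so both have nonpositive upper mean. *)
Lemma dominated_mean_functional (R : realType) (Z : ptopologicalType)
    (S : Z -> Z) (L : (Z -> R) -> R) :
  compact [set: Z] -> continuous S ->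
  linear_on [set f : Z -> R^o | continuous f] L ->
  dominated_on [set f : Z -> R^o | continuous f] L (upper_mean S) ->
  mean_functional L /\ invariant_functional S L.
Proof.
move=> cZ cS lL dL.
have lin a (f g : Z -> R) : continuous f -> continuous g ->
    L (fun z => a * f z + g z) = a * L f + L g by exact: lL.
have c0 c : continuous (fun _ : Z => (c : R)) by exact: cst_continuous.
have le_cst (f : Z -> R) c : continuous f -> (forall z, f z <= c) -> L f <= c.
  move=> cf fc; apply: le_trans (dL _ cf) _.
  apply: (@upper_mean_le _ _ S _ 1%N) => // z.
  by rewrite /orbit_sum big_nat1 mul1r; exact: fc.
have L0 : L (fun=> 0) = 0.
  have := lin 1 _ _ (c0 0) (c0 0).
  by rewrite /= !mul1r addr0; lra.
have LN (f : Z -> R) : continuous f -> L (fun z => -1 * f z) = - L f.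
  move=> cf; have := lin (-1) _ _ cf (c0 0); rewrite L0 addr0 mulN1r => <-.
  by congr L; apply/funext => z; rewrite addr0.
have mL : mean_functional L.
  split=> // [f cf f0|].
    have := le_cst (fun z => -1 * f z) 0 (continuous_scale cf).
    by rewrite LN// oppr_le0; apply => z; have := f0 z; lra.
  apply/eqP; rewrite eq_le le_cst//=.
  have := le_cst (fun z => -1 * 1) (-1) (c0 _).
  by rewrite (LN (fun=> 1))// lerN2; apply => z; rewrite mulr1.
split=> // f cf.
have cfS : continuous (f \o S).
  by move=> z; apply: continuous_comp; [exact: cS|exact: cf].
have half (s : R) : s = 1 \/ s = -1 ->
    L (fun z => s * (-1 * f z + f (S z))) <= 0.
  move=> s1; apply/ler_addgt0Pr => e e0; rewrite add0r.
  have cg : continuous (fun z => s * (-1 * f z + f (S z))).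
    by apply: continuous_scale; exact: continuous_affine.
  apply: le_trans (dL _ cg) _.
  have [M M0 fM] := compact_continuous_bounded cZ cf.
  (* The telescoped sum is at most [2 * M], hence at most [n * e] for this [n]. *)
  pose n := (Num.truncn (2 * M / e)).+1.
  apply: (@upper_mean_le _ _ S _ n) => // z.
  have -> : orbit_sum S (fun z => s * (-1 * f z + f (S z))) n z =
      s * (f (iter n S z) - f z).
    rewrite /orbit_sum -mulr_sumr; congr (_ * _).
    rewrite -[RHS](telescope_sumr (fun j => f (iter j S z)) (leq0n n)).
    by apply: eq_bigr => j _ /=; rewrite mulN1r addrC.
  have : 2 * M <= n%:R * e.
    by rewrite -ler_pdivrMr//; apply: ltW; exact: truncnS_gt.
  have := fM z; have := fM (iter n S z); rewrite !ler_norml => /andP[? ?] /andP[? ?].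
  by case: s1 => ->; lra.
have LE (s : R) : L (fun z => s * (-1 * f z + f (S z))) = s * (- L f + L (f \o S)).
  by rewrite meanZ ?lin ?mulN1r//; exact: continuous_affine.
have h1 := half 1 (or_introl erefl); have h2 := half (-1) (or_intror erefl).
by move: h1 h2; rewrite !LE; lra.
Qed.

Lemma cvg_unique_eq (R : realType) (u v : nat -> \bar R) (a b : \bar R) :
  (forall n, u n = v n) -> u n @[n --> \oo] --> a -> v n @[n --> \oo] --> b ->
  b = a.
Proof.
move=> uv ua vb; apply: (@cvg_unique _ _ (v @ \oo)) => //.
by rewrite -(funext uv).
Qed.

Lemma invariant_measure_integral (R : realType) (Z : ptopologicalType)
    (S : Z -> Z) (mu : probability (borel Z) R) (A : set (borel Z))
    (f : Z -> R) :
  compact [set: Z] -> continuous S -> continuous f -> invariant_measure S mu ->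
  measurable A -> S @^-1` A = A ->
  \int[mu]_(z in A) f (S z) = \int[mu]_(z in A) f z.
Proof.
move=> cZ cS cf iS mA SA.
have mS : measurable_fun setT (S : borel Z -> borel Z).
  exact: continuous_borel_map.
have cfS : continuous (fun z => f (S z)).
  by move=> z; apply: continuous_comp; [exact: cS|exact: cf].
rewrite /Rintegral; congr fine.
transitivity (\int[mu]_(z in S @^-1` A) (EFin \o f \o S) z)%E; first by rewrite SA.
rewrite -(integral_pushforward mS) //.
- by apply: eq_measure_integral => B mB _; exact: iS.
- by apply/measurable_EFinP; exact: continuous_borel.
- apply: (integrableS (E := setT)) => //; first by rewrite SA.
  exact: (continuous_integrable mu cZ cfS).
Qed.

Lemma conditional_mean (R : realType) (Z : ptopologicalType)
    (S : Z -> Z) (mu : probability (borel Z) R) (A : set (borel Z)) :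
  compact [set: Z] -> continuous S -> invariant_measure S mu ->
  measurable A -> S @^-1` A = A -> 0 < fine (mu A) ->
  let L := fun f : Z -> R => (fine (mu A))^-1 * \int[mu]_(z in A) f z in
  mean_functional L /\ invariant_functional S L.
Proof.
move=> cZ cS iS mA SA muA L.
have int (f : Z -> R) : continuous f -> mu.-integrable A (EFin \o f).
  move=> cf; apply: (integrableS (E := setT)) => //.
  exact: (continuous_integrable mu cZ cf).
split; last first.
  by move=> f cf; rewrite /L; congr (_ * _);
    exact: (@invariant_measure_integral _ _ S mu A f).
split.
- move=> a f g cf cg; rewrite /L RintegralD//; last 2 first.
  + by apply: int; exact: continuous_scale.
  + exact: int.
  by rewrite RintegralZl//; [ring|exact: int].
- move=> f cf f0; rewrite mulr_ge0 ?invr_ge0 ?(ltW muA)//.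
  exact: Rintegral_ge0.
- by rewrite /L Rintegral_cst// mul1r mulVf// gt_eqF.
Qed.

(* If [A] is invariant and [0 < mu A < 1], extremality identifies [mu] with its
   conditional measure on [A], which gives [mu A = 1]. *)
Theorem exists_maximizing_ergodic (R : realType) (Z : ptopologicalType)
    (S : Z -> Z) (h : Z -> R) :
  compact [set: Z] -> cozero_opens R Z -> continuous S -> continuous h ->
  exists2 mu : probability (borel Z) R, ergodic_measure S mu &
    \int[mu]_z h z = upper_mean S h.
Proof.
move=> cZ zZ cS ch.
have sD : subspace_set [set f : Z -> R^o | continuous f].
  split=> [|a f g /= cf cg]; first exact: cst_continuous.
  exact: (@continuous_affine R Z f g a cf cg).
have [L [lL dL Lh extL]] :=
  extreme_dominated_functional sD (@upper_mean_sublinear R Z S cZ) ch.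
have [mL iL] := dominated_mean_functional cZ cS lL dL.
have [mu muL] := riesz_representation cZ zZ mL.
have mS : measurable_fun setT (S : borel Z -> borel Z).
  exact: continuous_borel_map.
have cramp (phi : Z -> R) n : continuous phi ->
    continuous (fun z => Num.min (n%:R * phi z) 1).
  by move=> cphi; apply: continuous_min_cst; exact: continuous_scale.
have int (A : set (borel Z)) (f : Z -> R) : measurable A -> continuous f ->
    mu.-integrable A (EFin \o f).
  move=> mA cf; apply: (integrableS (E := setT)) => //.
  exact: (continuous_integrable mu cZ cf).
have fineint (A : set (borel Z)) (f : Z -> R) : measurable A -> continuous f ->
    (\int[mu]_(z in A) (f z)%:E)%E = (\int[mu]_(z in A) f z)%:E.
  by move=> mA cf; rewrite /Rintegral fineK//; apply: integrable_fin_num => //; exact: int.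
have iS : invariant_measure S mu.
  (* Invariance is checked on an open set where some [phi] is positive: its preimage is the set
     where [phi \o S] is positive, and the corresponding ramps have equal integrals because [L] is
     invariant. *)
  suff : forall B : set (borel Z), measurable B ->
      @pushforward _ _ (borel Z) (borel Z) R mu S B = mu B by [].
  apply: (@borel_measure_unique R Z
    (@pushforward _ _ (borel Z) (borel Z) R mu S) mu).
    by rewrite -[X in (X < _)%E]/(mu setT) (@probability_setT _ _ _ mu) ltry.
  move=> U /zZ[phi [cphi phi0 ->]]; rewrite /pushforward.
  have cphiS : continuous (fun z => phi (S z)).
    by move=> z; apply: continuous_comp; [exact: cS|exact: cphi].
  have := ramp_integral_cvg (mu := mu) measurableT cphiS (fun z => phi0 (S z)).
  have := ramp_integral_cvg (mu := mu) measurableT cphi phi0.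
  rewrite !setIT; apply: cvg_unique_eq => n.
  rewrite !fineint//; [|exact: cramp|exact: cramp].
  by rewrite !muL//; [rewrite -iL//; exact: cramp|exact: cramp|exact: cramp].
exists mu; last by rewrite muL.
split=> // A mA SA.
pose t := fine (mu A).
have tE : mu A = t%:E by rewrite /t fineK// fin_num_measure.
have t0 : 0 <= t by rewrite fine_ge0.
have t1 : t <= 1 by rewrite -lee_fin -tE; exact: probability_le1.
have [tE0|tn0] := eqVneq t 0; first by left; rewrite tE tE0.
have [tE1|tn1] := eqVneq t 1; first by right; rewrite tE tE1.
have tgt : 0 < t by rewrite lt_neqAle eq_sym tn0.
have tlt : t < 1 by rewrite lt_neqAle tn1.
have mAc : measurable (~` A) by exact: measurableC.
have tcE : mu (~` A) = (1 - t)%:E.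
  by rewrite (@probability_setC _ _ _ mu A mA) tE.
have SAc : S @^-1` (~` A) = ~` A by rewrite -preimage_setC SA.
have [mL1 iL1] := @conditional_mean _ _ _ mu A cZ cS iS mA SA tgt.
have tcgt : 0 < fine (mu (~` A)) by rewrite tcE /= subr_gt0.
have [mL2 iL2] := @conditional_mean _ _ _ mu (~` A) cZ cS iS mAc SAc tcgt.
have dom L' : mean_functional L' -> invariant_functional S L' ->
    dominated_on [set f : Z -> R^o | continuous f] L' (upper_mean S).
  by move=> mL' iL' f cf; exact: invariant_functional_dominated.
have lin L' : mean_functional L' ->
    linear_on [set f : Z -> R^o | continuous f] L'.
  by move=> [l' _ _] a f g cf cg; exact: l'.
have t01 : 0 < t < 1 by rewrite tgt.
(* [L] is the combination, with weights [t] and [1 - t], of the conditional means on [A] and on its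
   complement; extremality makes the first one equal to [L]. *)
have eqA (f : Z -> R) : continuous f -> \int[mu]_(z in A) f z = t * \int[mu]_z f z.
  move=> cf.
  have := extL _ _ t (lin _ mL1) (lin _ mL2) (dom _ mL1 iL1) (dom _ mL2 iL2) t01 _ f cf.
  rewrite muL// => <-; first by rewrite mulrA divff// mul1r.
  move=> g cg; rewrite tcE /= !mulrA divff// mul1r divff ?gt_eqF ?subr_gt0// mul1r.
  rewrite -muL// -Rintegral_setU//; rewrite ?setUv//; first exact: int.
  by apply/disj_setPS; rewrite setICr.
(* By [eqA] and the ramps the two measures agree on open sets, hence on Borel sets; at [A] itself
   this reads [t = t ^ 2]. *)
pose m1 : {measure set (borel Z) -> \bar R} := mrestr mu mA.
pose m2 : {measure set (borel Z) -> \bar R} := mscale (NngNum t0) mu.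
have : m1 A = m2 A.
  apply: borel_measure_unique => //.
    by rewrite /m1 /= /mrestr setTI tE ltry.
  move=> U /zZ[phi [cphi phi0 ->]]; rewrite /m1 /m2 /= /mrestr /mscale /=.
  have h1 := ramp_integral_cvg (mu := mu) mA cphi phi0.
  have := ramp_integral_cvg (mu := mu) measurableT cphi phi0.
  rewrite setIT => /(cvgeZl (isT : t%:E \is a fin_num)).
  move=> h2; apply/esym; move: h1 h2; apply: cvg_unique_eq => n.
  by rewrite !fineint// ?eqA//; exact: cramp.
rewrite /m1 /m2 /= /mrestr /mscale /= setIid tE -EFinM => -[].
move=> /esym/eqP; rewrite -subr_eq0 -[X in _ - X]mulr1 -mulrBr mulf_eq0.
by rewrite subr_eq0 (negPf tn0) (negPf tn1).
Qed.

Corollary uniform_ergodic_average (R : realType) (Z : ptopologicalType)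
    (S : Z -> Z) (h : Z -> R) :
  compact [set: Z] -> cozero_opens R Z -> continuous S -> continuous h ->
  (forall mu : probability (borel Z) R, ergodic_measure S mu ->
     \int[mu]_z h z = 0) ->
  forall e, 0 < e ->
  exists2 n, (0 < n)%N & forall z, `|orbit_sum S h n z| <= n%:R * e.
Proof.
move=> cZ zZ cS ch h0 e e0.
have um0 (g : Z -> R) : continuous g -> (forall mu : probability (borel Z) R,
    ergodic_measure S mu -> \int[mu]_z g z = 0) -> exists2 n, (0 < n)%N &
    forall z, orbit_sum S g n z <= n%:R * e.
  move=> cg g0; have [mu emu muE] := exists_maximizing_ergodic cZ zZ cS cg.
  have [n n0 hn] := upper_mean_approx S cZ cg e0.
  by exists n => // z; have := hn z; rewrite -muE g0// add0r.
have [n n0 hn] := um0 h ch h0.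
have [m m0 hm] : exists2 n, (0 < n)%N &
    forall z, orbit_sum S (fun z => -1 * h z) n z <= n%:R * e.
  apply: um0; first exact: continuous_scale.
  move=> mu emu; rewrite RintegralZl ?h0 ?mulr0//.
  exact: (continuous_integrable mu cZ ch).
(* The lengths found for [h] and for [- h] may differ; their product serves both. *)
exists (n * m)%N; first by rewrite muln_gt0 n0.
move=> z; rewrite ler_norml; apply/andP; split; last exact: orbit_sum_leM.
have := orbit_sum_leM n hm z; rewrite mulnC.
have -> : orbit_sum S (fun z => -1 * h z) (n * m) z = - orbit_sum S h (n * m) z.
  by rewrite /orbit_sum -mulr_sumr mulN1r.
lra.
Qed.

(** * Divergence of the sum of reciprocals of primes *)

(** Induction by removing the least prime factor: if it already belongs to the set obtained for the
    quotient, it leaves the set and enters the square. What counts afterwards is that there are only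
    [2 ^ K] sets. *)
Lemma squarefree_decomposition (K n : nat) : (0 < n)%N ->
  (forall p, p \in primes n -> (p < K)%N) ->
  exists (m : nat) (A : {set 'I_K}), n = (m ^ 2 * \prod_(i in A) i)%N.
Proof.
have [k] := ubnP n; elim: k n => // k IH n; rewrite ltnS => nk n0 smooth.
have [n1|n1] := leqP n 1.
  exists 1%N, finset.set0; rewrite big_set0; apply/eqP; rewrite eqn_leq n1.
  by rewrite exp1n muln1.
have pp := pdiv_prime n1; have pn := pdiv_dvd n.
have pK : (pdiv n < K)%N by apply: smooth; rewrite mem_primes pp n0.
pose p := Ordinal pK.
have [|||m [A nE]] := IH (n %/ pdiv n)%N.
- by apply: leq_trans nk; rewrite ltn_Pdiv// prime_gt1.
- by rewrite divn_gt0 ?prime_gt0// dvdn_leq.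
- move=> q; rewrite mem_primes => /and3P[qp _ qn]; apply: smooth.
  by rewrite mem_primes qp n0 (dvdn_trans qn (dvdn_div pn)).
have nE' : n = (pdiv n * (m ^ 2 * \prod_(i in A) i))%N by rewrite -nE mulnC divnK.
have [pA|pA] := boolP (p \in A).
  exists (m * pdiv n)%N, (A :\ p)%SET; rewrite {1}nE' (big_setD1 p pA) /=.
  by rewrite expnMn -!mulnn; ring.
exists m, (p |: A)%SET; rewrite {1}nE' big_setU1//= !mulnA; congr (_ * _)%N.
by rewrite -mulnA mulnC mulnn.
Qed.

Lemma smooth_count_le (K M : nat) :
  (\sum_(1 <= n < (M ^ 2).+1) all (fun p => p < K) (primes n) <=
    2 ^ K * M.+1)%N.
Proof.
pose f (x : {set 'I_K} * 'I_M.+1) : nat := (x.2 ^ 2 * \prod_(i in x.1) i)%N.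
apply: (@leq_trans (\sum_(1 <= n < (M ^ 2).+1) \sum_x (f x == n))%N).
  rewrite !big_nat; apply: leq_sum => n /andP[n0 nM].
  case: allP => //= sm; have [m [A nE]] := squarefree_decomposition n0 sm.
  have mM : (m < M.+1)%N.
    rewrite ltnS -leq_sqr; apply: leq_trans (nM : n <= M ^ 2)%N.
    by rewrite nE leq_pmulr//; move: n0; rewrite {1}nE muln_gt0 => /andP[].
  by rewrite (bigD1 (A, Ordinal mM))//= /f /= -nE eqxx.
rewrite exchange_big /=; apply: (@leq_trans (\sum_(x : {set 'I_K} * 'I_M.+1) 1)%N).
  apply: leq_sum => x _; case: (boolP (f x \in index_iota 1 (M ^ 2).+1)) => fx.
    rewrite (bigD1_seq (f x)) ?iota_uniq//= eqxx big1_seq ?addn0// => i.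
    by rewrite eq_sym => /andP[/negPf ->].
  rewrite big1_seq // => i /= ii; case: eqP => // fi; by rewrite fi ii in fx.
by rewrite sum1_card card_prod card_ord -(cardsT {set _}) -powersetT card_powerset cardsT card_ord.
Qed.

(** An [n] that is not smooth has a prime factor [p >= K], and [N %/ p] counts the multiples of [p]
    from 1 to [N]. *)
Lemma count_le_smooth_sum (K N : nat) :
  (N <= \sum_(1 <= n < N.+1) all (fun p => p < K) (primes n) +
    \sum_(K <= p < N.+1 | prime p) N %/ p)%N.
Proof.
under [X in (_ <= _ + X)%N]eq_bigr do rewrite divn_count_dvd.
rewrite exchange_big /= -big_split /=.
rewrite -[X in (X <= _)%N]muln1 -[X in (X * _)%N](subn1 N.+1) -sum_nat_const_nat.
rewrite !big_nat; apply: leq_sum => n /andP[n0 nN].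
have [//|/allPn[p pn]] := boolP (all (fun p => p < K)%N (primes n)).
rewrite -leqNgt => pK.
move: pn; rewrite mem_primes => /and3P[pp _ pn].
have ps : p \in index_iota K N.+1.
  by rewrite mem_index_iota pK (leq_trans _ nN)// ltnS dvdn_leq.
by rewrite big_mkcond (bigD1_seq p) ?iota_uniq//= pp pn addnCA.
Qed.

(* Erdos: if the tail from [K] on is at most 1/2, then at least half of the
   [n <= M^2] are [K]-smooth, yet there are at most [2^K (M + 1)] of these. *)
Lemma sum_prime_inv_unbounded (R : realType) (N0 : nat) (B : R) :
  exists x, B <= \sum_(N0 <= p < x | prime p) p%:R^-1.
Proof.
apply: contrapT => nB.
pose P x : R := \sum_(N0 <= p < x | prime p) p%:R^-1.
have ub x : P x <= B by rewrite leNgt; apply/negP => h; apply: nB; exists x; exact: ltW.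
have hs : has_sup (range P) by split; [exists (P 0%N), 0%N|exists B => _ [x _ <-]].
have [_ [x0 _ <-] x0P] := sup_adherent (ltac:(lra) : (0 : R) < 2^-1) hs.
have [K [N0K x0K]] : exists K, (N0 <= K)%N /\ (x0 <= K)%N.
  by exists (maxn N0 x0); rewrite leq_maxl leq_maxr.
have tail x : \sum_(K <= p < x | prime p) (p%:R : R)^-1 <= 2^-1.
  have [xK|Kx] := leqP x K; first by rewrite big_geq.
  have Px : P x <= sup (range P) by apply: ub_le_sup; [case: hs|exists x].
  have PK : P x0 <= P K.
    rewrite /P; have [x0N|Nx0] := leqP x0 N0.
      by rewrite big_geq// sumr_ge0// => p _; rewrite invr_ge0.
    rewrite (big_cat_nat (ltnW Nx0) x0K)/=.
    by rewrite lerDl sumr_ge0// => p _; rewrite invr_ge0.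
  have : P x = P K + \sum_(K <= p < x | prime p) (p%:R : R)^-1.
    by rewrite /P (big_cat_nat N0K (ltnW Kx)).
  lra.
(* With [y = 2 ^ K] and [M = 4 y], the count would give [8 y^2 <= 4 y^2 + y], which fails for
   [y >= 1]. *)
pose M := (2 ^ K.+2)%N.
have := count_le_smooth_sum K (M ^ 2).
move=> /leq_trans/(_ (leq_add (smooth_count_le K M) (leqnn _))).
rewrite -(ler_nat R) natrD natr_sum.
have : \sum_(K <= p < (M ^ 2).+1 | prime p) ((M ^ 2 %/ p)%N%:R : R) <=
    (M ^ 2)%:R / 2.
  apply: (@le_trans _ _ ((M ^ 2)%:R * \sum_(K <= p < (M ^ 2).+1 | prime p) (p%:R : R)^-1)).
    rewrite mulr_sumr; apply: ler_sum => p pp.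
    by rewrite ler_pdivlMr ?ltr0n ?prime_gt0// -natrM ler_nat leq_divM.
  by rewrite ler_wpM2l.
have ME : M%:R = 4 * (2 ^ K)%:R :> R by rewrite /M !expnS mulnA natrM.
rewrite (natrX _ M 2) natrM -[M.+1%:R]natr1 ME.
have : (1 : R) <= (2 ^ K)%:R by rewrite ler1n expn_gt0.
move: (2 ^ K)%:R => y.
move: (\sum_(K <= p < _ | prime p) _) => Q y1 Q_le le_Q.
by have : 0 <= (y - 1) * y; [apply: mulr_ge0; lra|lra].
Qed.

(** * The Katai criterion *)

Lemma normc_leD (R : realType) (x y : R[i]) : normc (x + y) <= normc x + normc y.
Proof. exact: le_normcD. Qed.

Lemma normc_ge0 (R : realType) (x : R[i]) : 0 <= normc x.
Proof. by case: x => a b; exact: sqrtr_ge0. Qed.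

Lemma normc_sum_le (R : realType) (I : Type) (r : seq I) (P : pred I)
    (F : I -> R[i]) :
  normc (\sum_(i <- r | P i) F i) <= \sum_(i <- r | P i) normc (F i).
Proof.
elim/big_rec2: _ => [|i y z _ h]; first by rewrite normc0.
by apply: le_trans (normc_leD _ _) _; rewrite lerD2l.
Qed.

Lemma normc_real (R : realType) (x : R) : normc x%:C%C = `|x|.
Proof. by rewrite /normc /= expr0n addr0 sqrtr_sqr. Qed.

Lemma normc_conjc (R : realType) (x : R[i]) : normc (conjc x) = normc x.
Proof. by case: x => a b /=; rewrite sqrrN. Qed.

Lemma mul_conjc (R : realType) (x : R[i]) : x * conjc x = ((normc x) ^+ 2)%:C%C.
Proof.
case: x => a b; rewrite /normc sqr_sqrtr ?addr_ge0 ?sqr_ge0//.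
by apply/eqP; rewrite eq_complex /= !mulrN opprK addrC [b * a]mulrC addNr !eqxx.
Qed.

(** * Counting multiples and the Turan-Kubilius inequality *)

Lemma sum_multiples (V : nmodType) (p N : nat) (g : nat -> V) : (0 < p)%N ->
  \sum_(0 <= n < N | (p %| n)%N) g n = \sum_(0 <= j < N | (p * j < N)%N) g (p * j)%N.
Proof.
move=> p0; case: N => [|N]; first by rewrite !big_geq.
rewrite !big_mkord.
have divN (i : 'I_N.+1) : (i %/ p < N.+1)%N.
  exact: leq_ltn_trans (leq_div _ _) (ltn_ord i).
rewrite (reindex_onto (fun j : 'I_N.+1 => inord (p * j) : 'I_N.+1)
  (fun n : 'I_N.+1 => inord (n %/ p) : 'I_N.+1)); last first.
  move=> i dvd_pi; rewrite (inordK (divN i)) mulnC (divnK dvd_pi).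
  exact: inord_val.
apply: eq_big => [j|j /andP[dvd_p /eqP jE]].
  have [jN|jN] := boolP (p * j < N.+1)%N.
    by rewrite (inordK jN) (dvdn_mulr _ (dvdnn p)) (mulKn _ p0) inord_val eqxx.
  apply/negP => /andP[dvd_p /eqP jE]; case/negP: jN.
  have := inordK (divN (inord (p * j))); rewrite jE => ->.
  by rewrite mulnC (divnK dvd_p).
congr g; have := inordK (divN (inord (p * j))); rewrite jE => jdiv.
by rewrite [in RHS]jdiv [RHS]mulnC (divnK dvd_p).
Qed.

(** Since [n = 0] is counted, the number of multiples is the ceiling of [N / d]; the lower bound has
    no error term, which keeps the first moment in Turan-Kubilius clean. *)
Lemma count_multiples_bounds (R : realType) (d N : nat) : (0 < d)%N ->
  (N%:R / d%:R : R) <= \sum_(0 <= n < N) ((d %| n)%N%:R : R) <=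
    (N%:R / d%:R + 1 : R).
Proof.
move=> d0; case: N => [|N]; first by rewrite big_geq// mul0r lexx add0r ler01.
have -> : \sum_(0 <= n < N.+1) (d %| n)%N%:R = (N %/ d)%:R + 1 :> R.
  by rewrite big_ltn// dvdn0 divn_count_dvd natr_sum addrC.
have d0' : (0 : R) < d%:R by rewrite ltr0n.
apply/andP; split.
  rewrite ler_pdivrMr// natr1 -natrM ler_nat; exact: ltn_ceil.
rewrite lerD2r ler_pdivlMr// -natrM ler_nat.
by apply: leq_trans (leq_divM _ _) _.
Qed.

(** Expand the square. Distinct primes [p], [q] contribute at most [N / (p q) + 1], which sums to
    [N m^2] plus errors; the diagonal adds [N m]. The cross term is at most [- 2 N m^2] and cancels
    the squares of [m]. The errors 1, one per pair, make up the square of the size of [s]. *)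
Lemma turan_kubilius (R : realType) (s : seq nat) (N : nat) (m : R) :
  uniq s -> all prime s -> m = \sum_(p <- s) p%:R^-1 ->
  \sum_(0 <= n < N) (\sum_(p <- s) (p %| n)%N%:R - m) ^+ 2 <=
    N%:R * m + (size s)%:R ^+ 2.
Proof.
move=> us /allP prs mE.
pose cnt d : R := \sum_(0 <= n < N) (d %| n)%N%:R.
have pgt p : p \in s -> (0 : R) < p%:R by move=> /prs pp; rewrite ltr0n prime_gt0.
have sizeE : \sum_(p <- s) (1 : R) = (size s)%:R.
  by rewrite big_const_seq count_predT iter_addr_0.
have sq : \sum_(0 <= n < N) (\sum_(p <- s) (p %| n)%N%:R) ^+ 2 <=
    N%:R * m ^+ 2 + N%:R * m + (size s)%:R ^+ 2 :> R.
  apply: (@le_trans _ _ (\sum_(p <- s) \sum_(q <- s)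
      (N%:R / (p%:R * q%:R) + 1 + (q == p)%:R * (N%:R / p%:R)))); last first.
    have -> : \sum_(p <- s) \sum_(q <- s)
        (N%:R / (p%:R * q%:R) + 1 + (q == p)%:R * (N%:R / p%:R)) =
      \sum_(p <- s) (N%:R * m * p%:R^-1 + (size s)%:R + N%:R * p%:R^-1) :> R.
      rewrite !big_seq; apply: eq_bigr => p ps.
      rewrite !big_split /= sizeE; congr (_ + _ + _).
        rewrite mE mulrAC mulr_sumr; apply: eq_bigr => q _.
        by rewrite invfM mulrA.
      rewrite (bigD1_seq p)//= eqxx mul1r big1 ?addr0// => q /negPf ->.
      by rewrite mul0r.
    rewrite !big_split /= -!mulr_sumr -mE.
    have -> : \sum_(p <- s) (size s)%:R = (size s)%:R ^+ 2 :> R.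
      by rewrite big_const_seq count_predT iter_addr_0 expr2 mulr_natr.
    lra.
  have -> : \sum_(0 <= n < N) (\sum_(p <- s) (p %| n)%N%:R) ^+ 2 =
      \sum_(p <- s) \sum_(q <- s) \sum_(0 <= n < N) (p %| n)%N%:R * (q %| n)%N%:R :> R.
    under eq_bigr do rewrite expr2 mulr_suml; rewrite exchange_big /=.
    apply: eq_bigr => p _; under eq_bigr do rewrite mulr_sumr.
    by rewrite exchange_big.
  rewrite !big_seq; apply: ler_sum => p ps; rewrite !big_seq; apply: ler_sum => q qs.
  have [->|qp] := eqVneq q p.
    rewrite mul1r; have -> : \sum_(0 <= n < N) (p %| n)%N%:R * (p %| n)%N%:R = cnt p.
      by apply: eq_bigr => n _; case: (p %| n)%N; rewrite ?mulr1 ?mulr0.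
    have /andP[_ /le_trans] := count_multiples_bounds R N (prime_gt0 (prs _ ps)).
    by apply; have : 0 <= N%:R / (p%:R * p%:R) :> R; [rewrite divr_ge0|lra].
  rewrite mul0r addr0.
  have -> : \sum_(0 <= n < N) (p %| n)%N%:R * (q %| n)%N%:R = cnt (p * q)%N.
    apply: eq_bigr => n _; rewrite Gauss_dvd -?mulnb ?natrM//.
    by rewrite prime_coprime ?prs// dvdn_prime2 ?prs// eq_sym.
  have pq0 : (0 < p * q)%N by rewrite muln_gt0 !prime_gt0 ?prs.
  by rewrite -natrM; have /andP[] := count_multiples_bounds R N pq0.
have lin : N%:R * m <= \sum_(0 <= n < N) \sum_(p <- s) (p %| n)%N%:R :> R.
  rewrite mE exchange_big mulr_sumr /= !big_seq; apply: ler_sum => p ps.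
  by have /andP[] := count_multiples_bounds R N (prime_gt0 (prs _ ps)).
have m0 : 0 <= m by rewrite mE; apply: sumr_ge0 => p _; rewrite invr_ge0.
have -> : \sum_(0 <= n < N) (\sum_(p <- s) (p %| n)%N%:R - m) ^+ 2 =
    \sum_(0 <= n < N) (\sum_(p <- s) (p %| n)%N%:R) ^+ 2
    - 2 * m * (\sum_(0 <= n < N) \sum_(p <- s) (p %| n)%N%:R) + N%:R * m ^+ 2.
  rewrite mulr_sumr -sumrN -big_split /=.
  have -> : N%:R * m ^+ 2 = \sum_(0 <= n < N) m ^+ 2 by rewrite sumr_const_nat subn0 mulr_natl.
  by rewrite -big_split /=; apply: eq_bigr => n _; ring.
have := ler_wpM2l m0 lin; lra.
Qed.

(** This is [o(N)] in the form of a bound for every [N], which can be used at lengths depending on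
    the primes or on the blocks. *)
Definition vanishing_mean (R : realType) (c : nat -> R[i]) :=
  forall e, 0 < e -> exists C : R, forall N,
    normc (\sum_(0 <= n < N) c n) <= e * N%:R + C.

(** A linearised Cauchy-Schwarz inequality: for fixed [t], a bound linear in [N] on the sum of
    squares gives one on the sum of absolute values, without square roots. *)
Lemma sum_norm_le_amgm (R : realType) (x : nat -> R) (t : R) N : 0 < t ->
  \sum_(0 <= n < N) `|x n| <=
    (t * \sum_(0 <= n < N) x n ^+ 2 + N%:R / t) / 2.
Proof.
move=> t0; have -> : N%:R / t = \sum_(0 <= n < N) t^-1.
  by rewrite sumr_const_nat subn0 mulr_natl.
rewrite mulr_sumr -big_split /= mulr_suml; apply: ler_sum => n _.
rewrite ler_pdivlMr// -(ler_pM2l t0) [leRHS]mulrDr mulfV ?gt_eqF//.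
rewrite -real_normK ?num_real//.
by have := sqr_ge0 (t * `|x n| - 1); lra.
Qed.

Lemma sum_lt_div (V : nmodType) (r N : nat) (g : nat -> V) : (0 < r)%N ->
  exists2 J, (J <= N)%N &
    \sum_(0 <= j < N | (r * j < N)%N) g j = \sum_(0 <= j < J) g j.
Proof.
move=> r0; pose J := ((N + r.-1) %/ r)%N.
have JP j : (j < J)%N = (r * j < N)%N.
  by rewrite leq_divRL// mulSn mulnC; lia.
have JN : (J <= N)%N.
  rewrite leqNgt JP -leqNgt; exact: leq_pmull.
exists J => //; rewrite (big_nat_widen _ _ _ _ _ JN).
by apply: eq_bigl => j; rewrite /= JP.
Qed.

(** Writing [n = p j], the two sums agree at [(p, j)] unless [p] divides [j]. The exceptions are
    multiples of [p^2] below [N]; there are at most [N / (W p) + 1] of them, each costing at most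
    [M + M^2]. *)
Lemma dilated_sum_error (R : realType) (u a : nat -> R[i]) (M m : R)
    (s : seq nat) (W N : nat) :
  multiplicative_function u -> (forall n, normc (u n) <= M) ->
  (forall n, normc (a n) <= 1) -> all prime s -> (0 < W)%N ->
  (forall p, p \in s -> (W <= p)%N) -> m = \sum_(p <- s) p%:R^-1 ->
  normc (\sum_(0 <= n < N) (\sum_(p <- s) (p %| n)%N%:R) * (a n * u n) -
    \sum_(0 <= j < N) u j * \sum_(p <- s | (p * j < N)%N) u p * a (p * j)%N)
  <= (M + M ^+ 2) * (N%:R * m / W%:R + (size s)%:R).
Proof.
move=> [_ umult] uM a1 /allP prs W0 Ws mE.
have M0 : 0 <= M := le_trans (normc_ge0 (u 0)) (uM 0).
have MM : 0 <= M + M ^+ 2 by rewrite addr_ge0// sqr_ge0.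
have -> : \sum_(0 <= n < N) (\sum_(p <- s) (p %| n)%N%:R) * (a n * u n) =
    \sum_(p <- s) \sum_(0 <= j < N | (p * j < N)%N) a (p * j)%N * u (p * j)%N :> R[i].
  under eq_bigr do rewrite mulr_suml; rewrite exchange_big /= !big_seq.
  apply: eq_bigr => p ps; rewrite -(sum_multiples N (fun n => a n * u n) (prime_gt0 (prs _ ps))).
  rewrite [RHS]big_mkcond; apply: eq_bigr => n _.
  by case: (p %| n)%N; rewrite ?mul1r ?mul0r.
have -> : \sum_(0 <= j < N) u j * \sum_(p <- s | (p * j < N)%N) u p * a (p * j)%N =
    \sum_(p <- s) \sum_(0 <= j < N | (p * j < N)%N) a (p * j)%N * (u p * u j).
  under eq_bigr do rewrite mulr_sumr; rewrite (exchange_big_dep predT)//=.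
  by apply: eq_bigr => p _; apply: eq_bigr => j _; ring.
rewrite -sumrN -big_split /=; apply: le_trans (normc_sum_le _ _ _) _.
have -> : (M + M ^+ 2) * (N%:R * m / W%:R + (size s)%:R) =
    \sum_(p <- s) (M + M ^+ 2) * (N%:R / W%:R * p%:R^-1 + 1).
  rewrite -mulr_sumr big_split /= -mulr_sumr -mE big_const_seq count_predT iter_addr_0.
  by rewrite mulrAC.
rewrite !big_seq; apply: ler_sum => p ps.
have pp := prs _ ps; have p0 := prime_gt0 pp.
rewrite -sumrN -big_split /=; apply: le_trans (normc_sum_le _ _ _) _.
apply: (@le_trans _ _ (\sum_(0 <= j < N | (p * j < N)%N)
    (M + M ^+ 2) * (p * p %| p * j)%N%:R)).
  apply: ler_sum => j _; rewrite dvdn_pmul2l//.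
  have [pj|pj] := boolP (p %| j)%N.
    rewrite mulr1 -mulrBr normcM.
    apply: le_trans (_ : 1 * normc (u (p * j)%N - u p * u j) <= _).
      by rewrite ler_wpM2r ?normc_ge0.
    rewrite mul1r; apply: le_trans (normc_leD _ _) _; rewrite normcN.
    by rewrite lerD// normcM expr2 ler_pM ?normc_ge0.
  (* The index [j = 0] is a multiple of [p] and was counted among the exceptions, so
     multiplicativity is used at positive arguments only. *)
  have j0 : (0 < j)%N by case: j pj => //; rewrite dvdn0.
  by rewrite umult ?prime_coprime// subrr normc0 mulr0.
rewrite -mulr_sumr ler_wpM2l//.
rewrite -(sum_multiples N (fun n => (p * p %| n)%N%:R : R) p0).
apply: (@le_trans _ _ (\sum_(0 <= n < N) ((p * p %| n)%N%:R : R))).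
  rewrite [leLHS]big_mkcond; apply: ler_sum => n _.
  by case: (p %| n)%N => //; rewrite ler0n.
have pp0 : (0 < p * p)%N by rewrite muln_gt0 p0.
have /andP[_ /le_trans] := count_multiples_bounds R N pp0; apply.
rewrite lerD2r -mulrA ler_wpM2l// natrM invfM ler_wpM2r ?invr_ge0//.
by rewrite lef_pV2 ?posrE ?ltr0n// ler_nat Ws.
Qed.

(** Expanding the square and summing over [j] first leaves correlations of dilates of [a]. On the
    diagonal there are at most [N / p + 1] terms of modulus at most 1, which yields [N m] plus the
    size of [s]. *)
Lemma dilated_second_moment (R : realType) (u a : nat -> R[i]) (M m : R)
    (s : seq nat) (N : nat) (K : nat -> nat -> R) :
  (forall n, normc (u n) <= M) -> (forall n, normc (a n) <= 1) ->
  uniq s -> all prime s -> m = \sum_(p <- s) p%:R^-1 ->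
  (forall p q, p \in s -> q \in s -> p != q ->
    normc (\sum_(0 <= j < N | (p * j < N)%N && (q * j < N)%N)
      a (p * j)%N * conjc (a (q * j)%N)) <= K p q) ->
  (forall p q, 0 <= K p q) ->
  \sum_(0 <= j < N)
    normc (\sum_(p <- s | (p * j < N)%N) u p * a (p * j)%N) ^+ 2 <=
  M ^+ 2 * (N%:R * m + (size s)%:R + \sum_(p <- s) \sum_(q <- s) K p q).
Proof.
move=> uM a1 us /allP prs mE hK K0.
pose c j := \sum_(p <- s | (p * j < N)%N) u p * a (p * j)%N.
pose k p q := \sum_(0 <= j < N | (p * j < N)%N && (q * j < N)%N)
  a (p * j)%N * conjc (a (q * j)%N).
have cE : \sum_(0 <= j < N) c j * conjc (c j) =
    \sum_(p <- s) \sum_(q <- s) u p * conjc (u q) * k p q.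
  transitivity (\sum_(0 <= j < N) \sum_(p <- s) \sum_(q <- s)
      if (p * j < N)%N && (q * j < N)%N then
        u p * conjc (u q) * (a (p * j)%N * conjc (a (q * j)%N)) else 0).
    apply: eq_bigr => j _; rewrite /c rmorph_sum mulr_suml big_mkcond /=.
    apply: eq_bigr => p _; case: ifP => pj; last first.
      by rewrite big1// => q _.
    rewrite mulr_sumr big_mkcond; apply: eq_bigr => q _ /=; case: ifP => // _.
    by rewrite rmorphM; ring.
  rewrite exchange_big; apply: eq_bigr => p _ /=.
  rewrite exchange_big; apply: eq_bigr => q _ /=.
  by rewrite /k mulr_sumr [RHS]big_mkcond.
have -> : \sum_(0 <= j < N) normc (c j) ^+ 2 =
    normc (\sum_(0 <= j < N) c j * conjc (c j)).
  have -> : \sum_(0 <= j < N) c j * conjc (c j) =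
      (\sum_(0 <= j < N) normc (c j) ^+ 2)%:C%C.
    by rewrite rmorph_sum; apply: eq_bigr => j _; rewrite mul_conjc.
  by rewrite normc_real ger0_norm// sumr_ge0// => j _; exact: sqr_ge0.
have M0 : 0 <= M := le_trans (normc_ge0 (u 0)) (uM 0).
rewrite cE; apply: le_trans (normc_sum_le _ _ _) _.
have -> : M ^+ 2 * (N%:R * m + (size s)%:R + \sum_(p <- s) \sum_(q <- s) K p q) =
    \sum_(p <- s) \sum_(q <- s)
      M ^+ 2 * ((q == p)%:R * (N%:R / p%:R + 1) + K p q).
  transitivity (\sum_(p <- s) M ^+ 2 * (N%:R / p%:R + 1 + \sum_(q <- s) K p q)).
    rewrite -mulr_sumr !big_split /= -mulr_sumr -mE.
    by rewrite big_const_seq count_predT iter_addr_0.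
  rewrite !big_seq; apply: eq_bigr => p ps.
  rewrite -mulr_sumr big_split /=; congr (_ * (_ + _)).
  rewrite (bigD1_seq p)//= eqxx mul1r big1 ?addr0//.
  by move=> q /negPf ->; rewrite mul0r.
rewrite !big_seq; apply: ler_sum => p ps.
apply: le_trans (normc_sum_le _ _ _) _; rewrite !big_seq; apply: ler_sum => q qs.
have uu : normc (u p * conjc (u q)) <= M ^+ 2.
  by rewrite normcM normc_conjc expr2 ler_pM ?normc_ge0.
rewrite normcM ler_pM ?normc_ge0//.
have [qp|qp] := eqVneq q p; last by rewrite mul0r add0r hK// eq_sym.
rewrite mul1r qp; apply: le_trans (_ : N%:R / p%:R + 1 <= _); last by rewrite lerDl.
have p0 := prime_gt0 (prs _ ps).
apply: le_trans (normc_sum_le _ _ _) _.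
apply: (@le_trans _ _ (\sum_(0 <= j < N | (p * j < N)%N) 1)).
  under eq_bigl do rewrite andbb.
  by apply: ler_sum => j _; rewrite normcM normc_conjc -[leRHS]mulr1 ler_pM ?normc_ge0.
rewrite -(sum_multiples N (fun=> 1 : R) p0).
have /andP[_] := count_multiples_bounds R N p0; apply: le_trans.
by rewrite [leLHS]big_mkcond; apply: ler_sum => n _; case: (p %| n)%N.
Qed.

(* With [om n] the number of [p] in [s] dividing [n] and [m] the sum of the
   [1 / p], Turan-Kubilius replaces [m * sum a u] by [sum om a u], which is close
   to [sum_j u(j) sum_p u(p) a(p j)]; there Cauchy-Schwarz leaves only the
   correlations.  Each error is at most [d m N + O(1)] up to a factor depending
   on [M] once [m >= 1 / d^2] and the primes exceed [1 / d]. *)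
Theorem katai_criterion (R : realType) (u a : nat -> R[i]) (M : R) (N0 : nat) :
  multiplicative_function u -> (forall n, normc (u n) <= M) ->
  (forall n, normc (a n) <= 1) ->
  (forall p q, prime p -> prime q -> (N0 <= p)%N -> (N0 <= q)%N -> p <> q ->
    vanishing_mean (fun j => a (p * j)%N * conjc (a (q * j)%N))) ->
  vanishing_mean (fun n => a n * u n).
Proof.
move=> umult uM a1 H e e0.
have M0 : 0 <= M := le_trans (normc_ge0 (u 0)) (uM 0).
(* [K] dominates the total coefficient of [d m N]: [M^3 + M / 2] from the second moment, [M + M^2]
   from the dilation error, [M] from Turan-Kubilius. The summand 1 keeps it positive if [M = 0]. *)
pose K := M ^+ 3 + M ^+ 2 + 3 * M + 1.
have K0 : 0 < K by rewrite /K ltr_wpDl// !addr_ge0// ?exprn_ge0// mulr_ge0.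
pose d := e / K; have d0 : 0 < d by rewrite divr_gt0.
have dK : d * K = e by rewrite /d divfK// gt_eqF.
pose W := maxn N0 (Num.truncn d^-1).+1.
have W0 : (0 < W)%N by rewrite leq_max orbT.
have Wd : W%:R^-1 <= d :> R.
  rewrite invf_ple ?posrE ?ltr0n//; apply: ltW.
  by apply: lt_le_trans (truncnS_gt _) _; rewrite ler_nat leq_maxr.
have [x mx] := sum_prime_inv_unbounded W (1 + d^-1 / d).
pose s := [seq p <- index_iota W x | prime p].
pose m := \sum_(p <- s) (p%:R : R)^-1.
have mE : m = \sum_(W <= p < x | prime p) p%:R^-1 by rewrite /m big_filter.
have us : uniq s by rewrite filter_uniq// iota_uniq.
have prs : all prime s by apply/allP => p; rewrite mem_filter => /andP[].
have Ws p : p \in s -> (W <= p)%N.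
  by rewrite mem_filter mem_index_iota => /and3P[].
have md : d^-1 / d <= m by rewrite mE; lra.
have m0 : 0 < m.
  by have : 0 < d^-1 / d; [rewrite divr_gt0 ?invr_gt0|lra].
pose D : R := (size s)%:R.
have D0 : 0 <= D by rewrite ler0n.
(* The correlations of at most [D^2] pairs then add up to at most [m N] plus a constant. *)
pose eps := m / (D ^+ 2 + 1).
have D21 : 0 < D ^+ 2 + 1 by rewrite ltr_wpDl// sqr_ge0.
have eps0 : 0 < eps by rewrite divr_gt0.
have /choice[C CP] (pq : nat * nat) : exists C : R, 0 <= C /\
    (pq.1 \in s -> pq.2 \in s -> pq.1 != pq.2 -> forall J,
      normc (\sum_(0 <= j < J) a (pq.1 * j)%N * conjc (a (pq.2 * j)%N)) <=
      eps * J%:R + C).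
  case: pq => p q /=.
  have [/and3P[ps qs pq]|h] := boolP [&& p \in s, q \in s & p != q]; last first.
    by exists 0; split=> // ps qs pq; rewrite ps qs pq in h.
  have NW r : r \in s -> (N0 <= r)%N.
    by move=> /Ws; apply: leq_trans; exact: leq_maxl.
  have [C hC] := H p q (allP prs _ ps) (allP prs _ qs) (NW _ ps) (NW _ qs)
    (elimN eqP pq) eps eps0.
  (* The bound at length 0 shows that its constant is nonnegative. *)
  exists C; split=> //; have := hC 0%N; rewrite big_geq// normc0 mulr0; lra.
pose Ct := \sum_(p <- s) \sum_(q <- s) C (p, q).
(* The parts independent of [N] in the bounds on [V], on [T - V] and on the deviation of [om] from
   [m]; the final inequality is divided by [m]. *)
pose c0 := M / 2 * (d * (M ^+ 2 * (D + Ct))) + (M + M ^+ 2) * D +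
  M / 2 * (d * D ^+ 2).
exists (c0 / m) => N.
pose om n : R := \sum_(p <- s) (p %| n)%N%:R.
pose c j := \sum_(p <- s | (p * j < N)%N) u p * a (p * j)%N.
have second : \sum_(0 <= j < N) normc (c j) ^+ 2 <=
    M ^+ 2 * (2 * (N%:R * m) + D + Ct).
  have hK p q : p \in s -> q \in s -> p != q ->
      normc (\sum_(0 <= j < N | (p * j < N)%N && (q * j < N)%N)
        a (p * j)%N * conjc (a (q * j)%N)) <= eps * N%:R + C (p, q).
    move=> ps qs pq.
    have pq0 : (0 < maxn p q)%N by rewrite leq_max prime_gt0// (allP prs _ ps).
    (* Both [p j < N] and [q j < N] hold exactly when [maxn p q * j < N], so the restricted
       correlation is an initial sum, of length [J <= N]. *)
    have [J JN JE] := sum_lt_div N (fun j => a (p * j)%N * conjc (a (q * j)%N)) pq0.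
    have -> : \sum_(0 <= j < N | (p * j < N)%N && (q * j < N)%N)
        a (p * j)%N * conjc (a (q * j)%N) =
      \sum_(0 <= j < J) a (p * j)%N * conjc (a (q * j)%N).
      rewrite -JE; by apply: eq_bigl => j; rewrite maxnMl gtn_max.
    have [_ /= /(_ ps qs pq J)/le_trans] := CP (p, q); apply.
    by rewrite lerD2r ler_wpM2l ?ler_nat// ltW.
  apply: le_trans (dilated_second_moment uM a1 us prs (erefl m) hK _) _.
    move=> p q; apply: addr_ge0; last by case: (CP (p, q)).
    by apply: mulr_ge0; [exact: ltW|exact: ler0n].
  rewrite ler_wpM2l ?sqr_ge0//.
  have -> : \sum_(p <- s) \sum_(q <- s) (eps * N%:R + C (p, q)) =
      D ^+ 2 * (eps * N%:R) + Ct.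
    under eq_bigr do rewrite big_split /= big_const_seq count_predT iter_addr_0.
    rewrite big_split /= big_const_seq count_predT iter_addr_0 -/Ct.
    by rewrite -mulrnA -[X in X + Ct]mulr_natl natrM expr2.
  have : D ^+ 2 * (eps * N%:R) <= N%:R * m.
    rewrite mulrA [leRHS]mulrC ler_wpM2r// /eps mulrA ler_pdivrMr//.
    by rewrite mulrC ler_wpM2l ?(ltW m0)// lerDl.
  rewrite -/D; lra.
(* The lower bound [d^-1 / d] on [m] absorbs the term [N / t] of the arithmetic-geometric
   inequality, used twice with [t = d]. *)
have Nd : N%:R / d <= d * (N%:R * m).
  have -> : N%:R / d = d * (N%:R * (d^-1 / d)) by field; rewrite gt_eqF.
  by rewrite !ler_wpM2l// ltW.
have omb := turan_kubilius N us prs (erefl m).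
have absom : \sum_(0 <= n < N) `|om n - m| <= (d * (N%:R * m + D ^+ 2) + d * (N%:R * m)) / 2.
  apply: le_trans (sum_norm_le_amgm (fun n => om n - m) N d0) _.
  by rewrite ler_pM2r ?invr_gt0// lerD// ler_pM2l.
have absc : \sum_(0 <= j < N) normc (c j) <=
    (d * (M ^+ 2 * (2 * (N%:R * m) + D + Ct)) + d * (N%:R * m)) / 2.
  have := sum_norm_le_amgm (fun n => normc (c n)) N d0.
  under eq_bigr do rewrite ger0_norm ?normc_ge0//.
  by move/le_trans; apply; rewrite ler_pM2r ?invr_gt0// lerD// ler_pM2l.
have err := dilated_sum_error N umult uM a1 prs W0 Ws (erefl m).
pose S := \sum_(0 <= n < N) a n * u n.
pose T : R[i] := \sum_(0 <= n < N) (\sum_(p <- s) (p %| n)%N%:R) * (a n * u n).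
pose V := \sum_(0 <= j < N) u j * c j.
have SE : m%:C%C * S = V + (T - V) - \sum_(0 <= n < N) (om n - m)%:C%C * (a n * u n).
  rewrite [V + _]addrC subrK.
  have -> : T = \sum_(0 <= n < N) (om n)%:C%C * (a n * u n).
    apply: eq_bigr => n _; rewrite rmorph_sum; congr (_ * _).
    by apply: eq_bigr => p _; rewrite rmorph_nat.
  rewrite -sumrN -big_split mulr_sumr /=; apply: eq_bigr => n _.
  by rewrite rmorphB; ring.
have mS : m * normc S <= normc V + normc (T - V) +
    M * \sum_(0 <= n < N) `|om n - m|.
  rewrite -[X in X * _](ger0_norm (ltW m0)) -normc_real -normcM SE.
  apply: le_trans (normc_leD _ _) _; rewrite normcN lerD ?normc_leD//.
  apply: le_trans (normc_sum_le _ _ _) _; rewrite mulr_sumr; apply: ler_sum => n _.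
  rewrite normcM normc_real mulrC ler_wpM2r// normcM -[leRHS]mul1r.
  by rewrite ler_pM ?normc_ge0.
have Vb : normc V <= M * \sum_(0 <= j < N) normc (c j).
  apply: le_trans (normc_sum_le _ _ _) _; rewrite mulr_sumr; apply: ler_sum => j _.
  by rewrite normcM ler_wpM2r ?normc_ge0.
rewrite -(ler_pM2l m0) mulrDr [X in _ <= _ + X]mulrC divfK ?gt_eqF//.
have h1 := ler_wpM2l M0 absom; have h2 := ler_wpM2l M0 absc.
have h3 : (M + M ^+ 2) * (N%:R * m / W%:R + D) <= (M + M ^+ 2) * (d * (N%:R * m) + D).
  rewrite ler_wpM2l ?addr_ge0 ?sqr_ge0// lerD2r mulrC ler_wpM2r//.
  by rewrite mulr_ge0// ltW.
have X0 : 0 <= d * (N%:R * m) by apply: mulr_ge0; [exact: ltW|apply: mulr_ge0 => //; exact: ltW].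
rewrite -dK /K /c0; rewrite -/D in err; rewrite -/T -/V in err.
have h4 := le_trans err h3.
have MX : 0 <= M * (d * (N%:R * m)) by rewrite mulr_ge0.
apply: (le_trans mS); lra.
Qed.

(** * Block sums *)

Lemma gap_sequence_mono (b : nat -> nat) : gap_sequence b ->
  {homo b : i j / (i <= j)%N}.
Proof.
move=> [_ bS _]; apply: homo_leq => //; first exact: leq_trans.
by move=> k; exact: ltnW.
Qed.

Lemma gap_sequence_ge (b : nat -> nat) k : gap_sequence b -> (k <= b k)%N.
Proof.
move=> [_ bS _]; elim: k => // k IH; exact: leq_ltn_trans IH (bS k).
Qed.

Lemma block_index_exists (b : nat -> nat) : gap_sequence b ->
  exists kap : nat -> nat, forall n, (b (kap n) <= n < b (kap n).+1)%N.
Proof.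
move=> [b0 bS _].
suff /choice[kap kapP] : forall n, exists k, (b k <= n < b k.+1)%N by exists kap.
elim=> [|n [k /andP[kn nk]]]; first by exists 0%N; rewrite b0 /= -{1}b0.
have [h|h] := ltnP n.+1 (b k.+1); first by exists k; rewrite (leqW kn).
exists k.+1; have -> : n.+1 = b k.+1 by apply/eqP; rewrite eqn_leq h nk.
by rewrite leqnn bS.
Qed.

Lemma block_index_mono (b kap : nat -> nat) : gap_sequence b ->
  (forall n, (b (kap n) <= n < b (kap n).+1)%N) ->
  {homo kap : n m / (n <= m)%N}.
Proof.
move=> bg kapP n m nm; rewrite leqNgt; apply/negP => h.
have /andP[kn _] := kapP n; have /andP[_ mk] := kapP m.
have := leq_trans (gap_sequence_mono bg h) kn.
by rewrite leqNgt (leq_ltn_trans nm mk).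
Qed.

Lemma block_index_eq (b kap : nat -> nat) n k : gap_sequence b ->
  (forall n, (b (kap n) <= n < b (kap n).+1)%N) ->
  (b k <= n < b k.+1)%N -> kap n = k.
Proof.
move=> bg kapP /andP[kn nk]; have /andP[h1 h2] := kapP n.
apply/eqP; rewrite eqn_leq; apply/andP; split; rewrite leqNgt; apply/negP => h.
  by have := leq_ltn_trans (leq_trans (gap_sequence_mono bg h) h1) nk; rewrite ltnn.
by have := leq_ltn_trans (leq_trans (gap_sequence_mono bg h) kn) h2; rewrite ltnn.
Qed.

(** The growth of the gaps enters here: from some [k0] on every block has length at least
    [G >= 1 / e], so [G * (kap n - k0) <= n], and [k0] is the constant. *)
Lemma block_index_sublinear (R : realType) (b kap : nat -> nat) (e : R) :
  gap_sequence b -> (forall n, (b (kap n) <= n < b (kap n).+1)%N) -> 0 < e ->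
  exists C : R, forall n, (kap n)%:R <= e * n%:R + C.
Proof.
move=> bg kapP e0; have [_ _ /cvgnyPge/(_ (Num.truncn e^-1).+1)] := bg.
set G := (Num.truncn e^-1).+1 => -[k0 _ hk0].
have Ge : e^-1 <= G%:R by apply: ltW; exact: truncnS_gt.
have bG k : (G * k <= b (k0 + k))%N.
  elim: k => [|k IH]; first by rewrite muln0.
  have /= h := hk0 (k0 + k)%N (leq_addr _ _).
  rewrite addnS mulnS; apply: leq_trans (leq_add h IH) _.
  by rewrite subnK //; apply: gap_sequence_mono.
exists k0%:R => n; have [kn|kn] := leqP (kap n) k0.
  by rewrite (@le_trans _ _ k0%:R) ?ler_nat// lerDr mulr_ge0// ltW.
have /andP[h _] := kapP n.
have := leq_trans (bG (kap n - k0)%N); rewrite subnKC ?(ltnW kn)// => /(_ _ h).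
rewrite -(ler_nat R) natrM natrB ?(ltnW kn)// => h2.
rewrite -lerBlDr -ler_pdivrMl//; apply: le_trans h2.
by rewrite ler_wpM2r// subr_ge0 ler_nat ltnW.
Qed.

Lemma iter_prod_map (X Y : Type) (f : X -> X) (g : Y -> Y) r s n z :
  iter n (prod_map (iter r f) (iter s g)) z =
  (iter (r * n) f z.1, iter (s * n) g z.2).
Proof.
elim: n => [|n IH]; first by rewrite !muln0; case: z.
by rewrite iterS IH /prod_map /= !mulnS !iterD.
Qed.

Lemma conjc_mul_real (R : realType) (z : R[i]) (x : R) :
  conjc (z * x%:C%C) = conjc z * x%:C%C.
Proof.
case: z => a b; apply/eqP; rewrite eq_complex /=.
by apply/andP; split; apply/eqP; ring.
Qed.

Lemma block_correlation_vanishing (R : realType) (W : Type) (T : W -> W)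
    (F : W -> R) (b kap : nat -> nat) (x : nat -> W) (ph : nat -> R[i])
    (r s : nat) :
  gap_sequence b -> (forall n, (b (kap n) <= n < b (kap n).+1)%N) ->
  (forall z, `|F z| <= 1) -> (forall k, normc (ph k) <= 1) ->
  (0 < r)%N -> (0 < s)%N ->
  (forall e : R, 0 < e -> exists2 L, (0 < L)%N & forall z,
    `|orbit_sum (prod_map (iter r T) (iter s T)) (fun z => F z.1 * F z.2) L z|
      <= L%:R * e) ->
  let a n := ph (kap n) * (F (iter (n - b (kap n)) T (x (kap n))))%:C%C in
  vanishing_mean (fun j => a (r * j)%N * conjc (a (s * j)%N)).
Proof.
move=> bg kapP F1 ph1 r0 s0 H a e e0.
have e20 : 0 < e / 2 by rewrite divr_gt0.
have [L L0 HL] := H _ e20.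
have kmono := block_index_mono bg kapP.
have a1 n : normc (a n) <= 1.
  by rewrite /a normcM normc_real -[leRHS]mulr1 ler_pM ?normc_ge0.
pose c j := a (r * j)%N * conjc (a (s * j)%N).
have c1 j : normc (c j) <= 1.
  by rewrite /c normcM normc_conjc -[leRHS]mulr1 ler_pM ?normc_ge0.
have L0' : (0 : R) < L%:R by rewrite ltr0n.
pose rs : R := r%:R + s%:R.
have rs0 : 0 < rs by rewrite addr_gt0 ?ltr0n.
(* Chosen so that the windows crossing a boundary, each costing at most [L], contribute
   [L * eta * (r + s) * N = (e / 2) * N] up to a constant. *)
pose eta := e / 2 / (L%:R * rs).
have eta0 : 0 < eta by rewrite divr_gt0// mulr_gt0.
have [C HC] := block_index_sublinear bg kapP eta0.
(* A window not contained in one block contributes trivially, but then one of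
   the two block indices increases along it; these increments telescope. *)
have window i : normc (\sum_(i * L <= n < i.+1 * L) c n) <=
    L%:R * (e / 2) + L%:R * ((kap (r * (i.+1 * L))%N)%:R - (kap (r * (i * L))%N)%:R)
    + L%:R * ((kap (s * (i.+1 * L))%N)%:R - (kap (s * (i * L))%N)%:R).
  have iL : (i * L <= i.+1 * L)%N by rewrite leq_mul2r leqnSn orbT.
  have rk : (kap (r * (i * L))%N <= kap (r * (i.+1 * L))%N)%N.
    by apply: kmono; rewrite leq_mul2l iL orbT.
  have sk : (kap (s * (i * L))%N <= kap (s * (i.+1 * L))%N)%N.
    by apply: kmono; rewrite leq_mul2l iL orbT.
  have triv : normc (\sum_(i * L <= n < i.+1 * L) c n) <= L%:R.
    apply: le_trans (normc_sum_le _ _ _) _.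
    apply: (@le_trans _ _ (\sum_(i * L <= n < i.+1 * L) 1)); first exact: ler_sum.
    by rewrite sumr_const_nat mulSn addnK.
  have rk' : (0 : R) <= (kap (r * (i.+1 * L))%N)%:R - (kap (r * (i * L))%N)%:R.
    by rewrite subr_ge0 ler_nat.
  have sk' : (0 : R) <= (kap (s * (i.+1 * L))%N)%:R - (kap (s * (i * L))%N)%:R.
    by rewrite subr_ge0 ler_nat.
  have Le : 0 <= L%:R * (e / 2) by rewrite mulr_ge0// ltW.
  have [/eqP rE|rN] := boolP (kap (r * (i * L))%N == kap (r * (i.+1 * L))%N)%N; last first.
    have h : (1 : R) <= (kap (r * (i.+1 * L))%N)%:R - (kap (r * (i * L))%N)%:R.
      by rewrite -natrB// ler1n subn_gt0 ltn_neqAle rN.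
    have := ler_wpM2l (ltW L0') h; have := ler_wpM2l (ltW L0') sk'; lra.
  have [/eqP sE|sN] := boolP (kap (s * (i * L))%N == kap (s * (i.+1 * L))%N)%N; last first.
    have h : (1 : R) <= (kap (s * (i.+1 * L))%N)%:R - (kap (s * (i * L))%N)%:R.
      by rewrite -natrB// ler1n subn_gt0 ltn_neqAle sN.
    have := ler_wpM2l (ltW L0') h; have := ler_wpM2l (ltW L0') rk'; lra.
  rewrite -rE -sE !subrr mulr0 !addr0.
  set k := kap (r * (i * L))%N in rE *; set k' := kap (s * (i * L))%N in sE *.
  pose z := (iter (r * (i * L) - b k)%N T (x k), iter (s * (i * L) - b k')%N T (x k')).
  have aE t j : (0 < t)%N -> (j < L)%N ->
      kap (t * (i * L))%N = kap (t * (i.+1 * L))%N ->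
      a (t * (j + i * L))%N = ph (kap (t * (i * L))%N) *
        (F (iter (t * j)%N T (iter (t * (i * L) - b (kap (t * (i * L))%N))%N T
          (x (kap (t * (i * L))%N)))))%:C%C.
    move=> t0 jL tE; have kE : kap (t * (j + i * L))%N = kap (t * (i * L))%N.
      apply/eqP; rewrite eqn_leq; apply/andP; split; last first.
        by apply: kmono; rewrite leq_mul2l leq_addl orbT.
      rewrite tE; apply: kmono; apply: leq_mul => //.
      by rewrite mulSn leq_add2r ltnW.
    rewrite /a kE -iterD mulnDr addnBA//.
    by have /andP[] := kapP (t * (i * L))%N.
  have -> : \sum_(i * L <= n < i.+1 * L) c n = ph k * conjc (ph k') *
      (orbit_sum (prod_map (iter r T) (iter s T)) (fun z => F z.1 * F z.2) L z)%:C%C.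
    have iLE : (i.+1 * L - i * L)%N = L by rewrite mulSn addnK.
    rewrite -{1}[(i * L)%N]add0n big_addn iLE /orbit_sum rmorph_sum mulr_sumr.
    rewrite !big_nat; apply: eq_bigr => j /andP[_ jL].
    rewrite /c !aE// iter_prod_map -/k -/k' conjc_mul_real.
    by rewrite (rmorphM (real_complex R)); ring.
  rewrite normcM normc_real normcM normc_conjc -[leRHS]mul1r.
  rewrite ler_pM ?mulr_ge0 ?normc_ge0//.
  by rewrite -[leRHS]mulr1 ler_pM ?normc_ge0.
have windows q : normc (\sum_(0 <= n < q * L) c n) <=
    (q * L)%:R * (e / 2) + L%:R * ((kap (r * (q * L))%N)%:R + (kap (s * (q * L))%N)%:R).
  (* Subtracting the value at 0 turns the bound into an exact telescoping sum, and the induction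
     starts with an equality. *)
  suff : normc (\sum_(0 <= n < q * L) c n) <= (q * L)%:R * (e / 2) +
      L%:R * ((kap (r * (q * L))%N)%:R + (kap (s * (q * L))%N)%:R)
      - L%:R * ((kap 0)%:R + (kap 0)%:R).
    move=> h; apply: le_trans h _; rewrite gerBl.
    by rewrite mulr_ge0// addr_ge0.
  elim: q => [|q IH].
    by rewrite !mul0n !muln0 big_geq// normc0 mul0r add0r subrr.
  have qL : (q * L <= q.+1 * L)%N by rewrite leq_mul2r leqnSn orbT.
  rewrite (big_cat_nat (leq0n _) qL) /=.
  apply: le_trans (normc_leD _ _) _; have := window q.
  have -> : (q.+1 * L)%:R = (q * L)%:R + L%:R :> R by rewrite mulSn addnC natrD.
  lra.
(* [L * C] for each of the two dilations, and [L] for the incomplete last window. *)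
exists (2 * L%:R * C + L%:R) => N.
have qN : ((N %/ L) * L <= N)%N by exact: leq_divM.
rewrite (big_cat_nat (leq0n _) qN) /=.
apply: le_trans (normc_leD _ _) _.
have rest : normc (\sum_((N %/ L) * L <= n < N) c n) <= L%:R.
  apply: le_trans (normc_sum_le _ _ _) _.
  apply: (@le_trans _ _ (\sum_((N %/ L) * L <= n < N) 1)); first exact: ler_sum.
  rewrite sumr_const_nat ler_nat; apply: ltnW.
  by rewrite {1}(divn_eq N L) addKn ltn_pmod.
have h1 := windows (N %/ L)%N.
have h2 : ((N %/ L) * L)%:R * (e / 2) <= N%:R * (e / 2).
  by rewrite ler_wpM2r ?ler_nat// ltW.
have hk t : (kap (t * ((N %/ L) * L))%N)%:R <= eta * (t%:R * N%:R) + C.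
  apply: le_trans (HC _) _; rewrite lerD2r ler_wpM2l ?(ltW eta0)// natrM.
  by rewrite ler_wpM2l// ler_nat.
have h3 := ler_wpM2l (ltW L0') (lerD (hk r) (hk s)).
have h4 : L%:R * (eta * (r%:R * N%:R) + eta * (s%:R * N%:R)) = N%:R * (e / 2).
  by rewrite /eta /rs; field; rewrite -/rs !gt_eqF.
lra.
Qed.

Lemma phase_exists (R : realType) (z : R[i]) :
  exists2 ph : R[i], normc ph <= 1 & ph * z = (normc z)%:C%C.
Proof.
have [z0|z0] := eqVneq (normc z) 0.
  by exists 0; rewrite ?normc0 ?ler01// mul0r z0.
exists (conjc z * ((normc z)^-1)%:C%C).
  rewrite normcM normc_conjc normc_real ger0_norm ?invr_ge0 ?normc_ge0//.
  by rewrite mulfV.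
rewrite mulrAC [conjc z * z]mulrC mul_conjc -rmorphM /=.
by rewrite expr2 mulfK.
Qed.

(** The additive constant disappears after division because [b K >= K]. *)
Lemma block_mean_cvg0 (R : realType) (b : nat -> nat) (v : nat -> nat -> R[i]) :
  gap_sequence b ->
  (forall e, 0 < e -> exists C : R, forall K,
    \sum_(0 <= k < K) normc (\sum_(b k <= n < b k.+1) v k n) <=
      e * (b K)%:R + C) ->
  block_mean b v @ \oo --> (0 : R).
Proof.
move=> bg H; apply/cvgr0Pnorm_le => e e0.
have e20 : 0 < e / 2 by rewrite divr_gt0.
have [C HC] := H _ e20.
exists (Num.truncn (`|C| / (e / 2))).+1 => // K /= hK.
have K0 : (0 : R) < K%:R by rewrite ltr0n; apply: leq_trans hK.
have bK : K%:R <= (b K)%:R :> R by rewrite ler_nat; exact: gap_sequence_ge.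
have bK0 := lt_le_trans K0 bK.
have CK : `|C| <= K%:R * (e / 2).
  rewrite -ler_pdivrMr//; apply: ltW; apply: lt_le_trans (truncnS_gt _) _.
  by rewrite ler_nat.
rewrite /block_mean ger0_norm; last first.
  by rewrite mulr_ge0 ?invr_ge0// sumr_ge0// => k _; exact: normc_ge0.
rewrite ler_pdivrMl//; apply: le_trans (HC K) _.
have := ler_wpM2r (ltW e20) bK; have := ler_norm C; lra.
Qed.

Theorem block_mean_cvg0_of_correlations (R : realType) (W : Type) (T : W -> W)
    (F : W -> R) (u : nat -> R[i]) (M : R) (N0 : nat) :
  multiplicative_function u -> (forall n, normc (u n) <= M) ->
  (forall z, `|F z| <= 1) ->
  (forall r s, prime r -> prime s -> (N0 <= r)%N -> (N0 <= s)%N -> r <> s ->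
    forall e : R, 0 < e -> exists2 L, (0 < L)%N & forall z,
    `|orbit_sum (prod_map (iter r T) (iter s T)) (fun z => F z.1 * F z.2) L z|
      <= L%:R * e) ->
  forall b, gap_sequence b -> forall x : nat -> W,
  block_mean b (fun k n => (F (iter (n - b k) T (x k)))%:C%C * u n) @ \oo -->
    (0 : R).
Proof.
move=> umult uM F1 H b bg x; apply: block_mean_cvg0 => // e e0.
have [kap kapP] := block_index_exists bg.
pose S k := \sum_(b k <= n < b k.+1) (F (iter (n - b k) T (x k)))%:C%C * u n.
have /choice[ph phP] k : exists ph : R[i], normc ph <= 1 /\ ph * S k = (normc (S k))%:C%C.
  by have [ph ? ?] := phase_exists (S k); exists ph.
have ph1 k : normc (ph k) <= 1 by case: (phP k).
pose a n := ph (kap n) * (F (iter (n - b (kap n)) T (x (kap n))))%:C%C.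
have a1 n : normc (a n) <= 1.
  by rewrite /a normcM normc_real -[leRHS]mulr1 ler_pM ?normc_ge0.
have vm : vanishing_mean (fun n => a n * u n).
  apply: (@katai_criterion _ _ _ M N0) => // p q pp pq Np Nq npq.
  apply: (@block_correlation_vanishing R W T F b kap x ph p q) => //.
  - exact: prime_gt0.
  - exact: prime_gt0.
  - exact: H.
have [C HC] := vm e e0; exists C => K.
have SE : (\sum_(0 <= k < K) normc (S k))%:C%C = \sum_(0 <= n < b K) a n * u n.
  elim: K => [|K IH].
    by have [-> _ _] := bg; rewrite !big_geq.
  rewrite big_nat_recr//= rmorphD /= IH.
  rewrite (big_cat_nat (leq0n _) (gap_sequence_mono bg (leqnSn K))) /=.
  congr (_ + _); have [_ <-] := phP K; rewrite /S mulr_sumr !big_nat.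
  apply: eq_bigr => n nK; have kn := block_index_eq bg kapP nK.
  by rewrite /a kn mulrA.
have := HC (b K); rewrite -SE normc_real; apply: le_trans; exact: ler_norm.
Qed.

(** * Joinings and tensor products *)

(** The function is the distance to the complement of [U]. Composing with [contract] keeps it real
    valued even when the complement is empty and the distance is infinite. *)
Lemma pseudometric_cozero_opens (R : realType) (Z : pseudoMetricType R) :
  cozero_opens R Z.
Proof.
move=> U oU; exists (fun z => contract (edist_inf (~` U) z)); split.
- move=> z; apply/cvgrPdist_lt => e e0.
  have near_z : \forall w \near z,
      ball (edist_inf (~` U) z) e (edist_inf (~` U) w).
    by apply: (@edist_inf_continuous R Z (~` U) z); exact: nbhsx_ballx.
  by near=> w; near: w.
- by move=> z; rewrite -(contract0 R) le_contract edist_inf_ge0.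
apply/seteqP; split => z /=; rewrite -(contract0 R) lt_contract; last first.
  by move=> h; apply: contrapT => nUz; rewrite edist_inf0 ?ltxx in h.
move=> Uz; have /nbhs_ballP[e /= e0 eU] : nbhs z U by exact: open_nbhs_nbhs.
apply: (@lt_le_trans _ _ e%:E); first by rewrite lte_fin.
apply: le_ereal_inf_tmp => _ [a nUa <-]; rewrite leNgt; apply/negP.
by move=> /edist_lt_ball /= /eU.
Unshelve. all: by end_near. Qed.

Lemma fubini_integral0 (R : realType) (d1 d2 : measure_display)
    (T1 : measurableType d1) (T2 : measurableType d2)
    (m1 : probability T1 R) (m2 : probability T2 R) (h : T1 * T2 -> R) (M : R) :
  measurable_fun setT h -> (forall z, `|h z| <= M) ->
  (forall x, (\int[m2]_y (h (x, y))%:E = 0)%E) ->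
  (\int[(m1 \x m2)%E]_z (h z)%:E = 0)%E.
Proof.
move=> mh hM h0.
have ih : (m1 \x m2)%E.-integrable setT (EFin \o h).
  apply: measurable_bounded_integrable => //.
    apply: (@le_lt_trans _ _ 1%E); last exact: ltry.
    exact: (@probability_le1 _ _ _ (m1 \x m2)%E).
  exists M; split; first exact: num_real.
  by move=> y My z _ /=; apply: le_trans (hM z) (ltW My).
rewrite -(integral12_prod_meas1 ih) /fubini_F.
by under eq_integral do rewrite h0; exact: integral0.
Qed.

Lemma integral_pushforward_product (R : realType)
    (d d1 d2 : measure_display) (T : measurableType d)
    (T1 : measurableType d1) (T2 : measurableType d2)
    (lam : probability T R) (m1 : probability T1 R) (m2 : probability T2 R)
    (phi : T -> T1 * T2) (h : T1 * T2 -> R) :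
  measurable_fun setT phi -> measurable_fun setT h ->
  lam.-integrable setT (EFin \o (h \o phi)) ->
  (forall A, measurable A -> lam (phi @^-1` A) = (m1 \x m2)%E A) ->
  (\int[lam]_z (h (phi z))%:E = \int[(m1 \x m2)%E]_w (h w)%:E)%E.
Proof.
move=> mphi mh ih lamE.
transitivity (\int[pushforward lam phi]_w (EFin \o h) w)%E.
  by rewrite (integral_pushforward mphi)//; exact/measurable_EFinP.
by apply: eq_measure_integral => A mA _; exact: lamE.
Qed.

Lemma continuous_fst (X Y : topologicalType) : continuous (@fst X Y).
Proof. by move=> z; exact: cvg_fst. Qed.

Lemma continuous_snd (X Y : topologicalType) : continuous (@snd X Y).
Proof. by move=> z; exact: cvg_snd. Qed.

Lemma continuous_compose (X Y Z : topologicalType) (f : X -> Y) (g : Y -> Z) :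
  continuous f -> continuous g -> continuous (fun x => g (f x)).
Proof. by move=> cf cg x; apply: continuous_comp; [exact: cf|exact: cg]. Qed.

Lemma continuous_pair (X Y Z : topologicalType) (f : Z -> X) (g : Z -> Y) :
  continuous f -> continuous g -> continuous (fun z => (f z, g z)).
Proof. by move=> cf cg z; apply: cvg_pair; [exact: cf|exact: cg]. Qed.

Lemma continuous_product (R : realType) (Z : topologicalType) (f g : Z -> R) :
  continuous f -> continuous g -> continuous (fun z => f z * g z).
Proof. by move=> cf cg z; apply: continuousM; [exact: cf|exact: cg]. Qed.

Lemma permuted_product_integral0 (R : realType) (X Y : pmetricType R)
    (lam : probability (borel ((X * Y) * (X * Y))%type) R)
    (rho : probability (borel (X * X)%type) R) (muY : probability (borel Y) R)
    (f : X -> R) (g : Y -> R) :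
  compact [set: X] -> compact [set: Y] ->
  is_permuted_product lam rho muY -> continuous f -> continuous g ->
  (forall x, `|f x| <= 1) -> (forall y, `|g y| <= 1) -> \int[muY]_y g y = 0 ->
  \int[lam]_z (f z.1.1 * g z.1.2 * (f z.2.1 * g z.2.2)) = 0.
Proof.
move=> cX cY lamP cf cg f1 g1 g0.
pose Z := ((X * Y) * (X * Y))%type.
have c11 : continuous (fun z : Z => z.1.1).
  by apply: continuous_compose; [exact: continuous_fst|exact: continuous_fst].
have c12 : continuous (fun z : Z => z.1.2).
  by apply: continuous_compose; [exact: continuous_fst|exact: continuous_snd].
have c21 : continuous (fun z : Z => z.2.1).
  by apply: continuous_compose; [exact: continuous_snd|exact: continuous_fst].
have c22 : continuous (fun z : Z => z.2.2).
  by apply: continuous_compose; [exact: continuous_snd|exact: continuous_snd].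
(* The product of the Borel sigma-algebras, on which Fubini's theorem is stated. *)
pose P := (borel (X * X)%type * (borel Y * borel Y))%type.
pose H (w : P) : R := f w.1.1 * f w.1.2 * (g w.2.1 * g w.2.2).
have mperm : measurable_fun setT (@permute_coord X Y : borel Z -> P).
  apply: measurable_fun_pair.
    apply: (@continuous_borel_map Z (X * X)%type (fun z => (z.1.1, z.2.1))).
    exact: continuous_pair.
  apply: measurable_fun_pair.
    exact: (@continuous_borel_map Z Y (fun z => z.1.2)).
  exact: (@continuous_borel_map Z Y (fun z => z.2.2)).
have mff : measurable_fun setT (fun w : borel (X * X)%type => f w.1 * f w.2).
  apply: (@continuous_borel R (X * X)%type (fun w => f w.1 * f w.2)).
  by apply: continuous_product; apply: continuous_compose => //;
    [exact: continuous_fst|exact: continuous_snd].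
have mg : measurable_fun setT (g : borel Y -> R) by exact: continuous_borel.
have mgg : measurable_fun setT (fun w : borel Y * borel Y => g w.1 * g w.2).
  by apply: measurable_funM; apply: measurableT_comp.
have mH : measurable_fun setT H.
  by apply: measurable_funM; [apply: (measurableT_comp mff)|apply: (measurableT_comp mgg)].
have HE : (\int[(rho \x (muY \x muY))%E]_w (H w)%:E = 0)%E.
  apply: (@fubini_integral0 R _ _ _ _ rho (muY \x muY)%E H 1) => //.
    by move=> w; rewrite /H !normrM !mulr_ile1 ?mulr_ge0.
  move=> xx; apply: (@fubini_integral0 R _ _ _ _ muY muY
      (fun w => f xx.1 * f xx.2 * (g w.1 * g w.2)) 1).
  - by apply: measurable_funM.
  - by move=> w; rewrite !normrM !mulr_ile1 ?mulr_ge0.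
  move=> y /=.
  under eq_integral do rewrite mulrA EFinM.
  rewrite integralZl//; last exact: (continuous_integrable muY cY cg).
  suff -> : (\int[muY]_y (g y)%:E = 0)%E by rewrite mule0.
  rewrite -[LHS]fineK; last first.
    apply: integrable_fin_num => //; exact: (continuous_integrable muY cY cg).
  by rewrite -[fine _]/(Rintegral muY setT g) g0.
have cZ : compact [set: Z].
  have -> : [set: Z] = (setT `*` setT) `*` (setT `*` setT) by rewrite !setXTT.
  by apply: compact_setX; apply: compact_setX.
have ch : continuous (fun z : Z => f z.1.1 * g z.1.2 * (f z.2.1 * g z.2.2)).
  by apply: continuous_product; apply: continuous_product;
    apply: continuous_compose.
have HpermE : H \o @permute_coord X Y =
    fun z : Z => f z.1.1 * g z.1.2 * (f z.2.1 * g z.2.2).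
  by apply/funext => z /=; rewrite /H /=; ring.
rewrite /Rintegral -[RHS]/(fine 0%E) -HE; congr fine.
rewrite -(@integral_pushforward_product R _ _ _ (borel Z) _ _ lam rho
  (muY \x muY)%E (@permute_coord X Y) H mperm mH).
- by apply: eq_integral => z _; congr EFin; rewrite /H /=; ring.
- by rewrite HpermE; exact: (continuous_integrable lam cZ ch).
move=> A mA; apply: lamP.
(* The identity is measurable from the Borel sets of the product space to [P]; thus every set
   measurable in [P] is Borel and the hypothesis on [lam] applies to it. *)
have mid : measurable_fun setT
    ((fun w => (w.1, (w.2.1, w.2.2))) : borel ((X * X) * (Y * Y))%type -> P).
  apply: measurable_fun_pair.
    exact: (@continuous_borel_map ((X * X) * (Y * Y))%type (X * X)%type
      _ (@continuous_fst _ _)).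
  apply: measurable_fun_pair.
    apply: (@continuous_borel_map ((X * X) * (Y * Y))%type Y (fun w => w.2.1)).
    exact: continuous_compose (@continuous_snd _ _) (@continuous_fst _ _).
  apply: (@continuous_borel_map ((X * X) * (Y * Y))%type Y (fun w => w.2.2)).
  exact: continuous_compose (@continuous_snd _ _) (@continuous_snd _ _).
have := mid measurableT A mA; rewrite setTI.
by congr (measurable _); apply/seteqP; split => -[x [y y']].
Qed.

(** * Real observables, linear combinations and uniform approximation *)

Lemma normc_Re_le (R : realType) (z : R[i]) : `|complex.Re z| <= normc z.
Proof.
by case: z => a b /=; rewrite -sqrtr_sqr ler_wsqrtr// lerDl sqr_ge0.
Qed.

Lemma normc_Im_le (R : realType) (z : R[i]) : `|complex.Im z| <= normc z.
Proof.
by case: z => a b /=; rewrite -sqrtr_sqr ler_wsqrtr// lerDr sqr_ge0.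
Qed.

(** The norm of [R[i]] has values in [R[i]], so continuity quantifies over positive complex [e];
    positivity there includes being real, which reduces the condition to real [e]. *)
Lemma continuous_normcP (R : realType) (Z : topologicalType)
    (F : Z -> R[i]^o) :
  continuous F <->
  forall z (e : R), 0 < e -> \forall w \near z, normc (F z - F w) < e.
Proof.
split=> [cF z e e0|H z].
  have e0' : (0 : R[i]) < e%:C%C by rewrite ltcR.
  have /cvgrPdist_lt/(_ _ e0') := cF z.
  by apply: filterS => w; rewrite -[`|_|]/((normc (F z - F w))%:C%C) ltcR.
apply/cvgrPdist_lt => e e0.
have eE : e = (complex.Re e)%:C%C.
  by move: e0; rewrite ltcE /= => /andP[/eqP h _]; case: e h => a b /= ->.
have e0' : 0 < complex.Re e by rewrite eE ltcR in e0.
have := H z _ e0'; apply: filterS => w.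
by rewrite [X in _ -> _ < X]eE -[`|_|]/((normc (F z - F w))%:C%C) ltcR.
Qed.

Lemma continuous_Re (R : realType) (Z : topologicalType) (F : Z -> R[i]^o) :
  continuous F -> continuous (fun z => complex.Re (F z)).
Proof.
move=> /continuous_normcP cF z; apply/cvgrPdist_lt => e e0.
have := cF z e e0; apply: filterS => w; apply: le_lt_trans.
by rewrite -[_ - _](raddfB (@complex.Re R)); exact: normc_Re_le.
Qed.

Lemma continuous_Im (R : realType) (Z : topologicalType) (F : Z -> R[i]^o) :
  continuous F -> continuous (fun z => complex.Im (F z)).
Proof.
move=> /continuous_normcP cF z; apply/cvgrPdist_lt => e e0.
have := cF z e e0; apply: filterS => w; apply: le_lt_trans.
by rewrite -[_ - _](raddfB (@complex.Im R)); exact: normc_Im_le.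
Qed.

Lemma continuous_real_complex (R : realType) (Z : topologicalType) (f : Z -> R) :
  continuous f -> continuous (fun z => (f z)%:C%C : R[i]^o).
Proof.
move=> cf; apply/continuous_normcP => z e e0.
have /cvgrPdist_lt/(_ _ e0) := cf z; apply: filterS => w.
by rewrite -(rmorphB (real_complex R)) normc_real.
Qed.

Definition real_momo (R : realType) (Z : Type) (T : Z -> Z) (u : nat -> R[i])
    (f : Z -> R) :=
  forall b, gap_sequence b -> forall x : nat -> Z,
    block_mean b (fun k n => (f (iter (n - b k) T (x k)))%:C%C * u n) @ \oo -->
      (0 : R).

Lemma block_mean_ge0 (R : realType) b (v : nat -> nat -> R[i]) K :
  0 <= block_mean b v K.
Proof.
by rewrite mulr_ge0 ?invr_ge0// sumr_ge0// => k _; exact: normc_ge0.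
Qed.

Lemma block_meanD (R : realType) b (v w : nat -> nat -> R[i]) K :
  block_mean b (fun k n => v k n + w k n) K <= block_mean b v K + block_mean b w K.
Proof.
rewrite /block_mean -mulrDr ler_wpM2l ?invr_ge0// -big_split /=.
by apply: ler_sum => k _; rewrite big_split; exact: normc_leD.
Qed.

Lemma block_meanZ (R : realType) b (v : nat -> nat -> R[i]) (c : R[i]) K :
  block_mean b (fun k n => c * v k n) K = normc c * block_mean b v K.
Proof.
rewrite /block_mean mulrCA; congr (_ * _); rewrite mulr_sumr.
by apply: eq_bigr => k _; rewrite -mulr_sumr normcM.
Qed.

Lemma block_mean_le (R : realType) b (v : nat -> nat -> R[i]) (e : R) K :
  gap_sequence b -> (forall k n, normc (v k n) <= e) -> block_mean b v K <= e.
Proof.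
move=> bg ve; have e0 : 0 <= e := le_trans (normc_ge0 _) (ve 0 0)%N.
have sum_le : \sum_(0 <= k < K) normc (\sum_(b k <= n < b k.+1) v k n) <=
    (b K)%:R * e.
  elim: K => [|K IH]; first by rewrite big_geq// mulr_ge0.
  have bK := gap_sequence_mono bg (leqnSn K).
  rewrite big_nat_recr//= -(subnK bK) natrD mulrDl addrC; apply: lerD => //.
  rewrite subnK//; apply: le_trans (normc_sum_le _ _ _) _.
  apply: (@le_trans _ _ (\sum_(b K <= n < b K.+1) e)); first exact: ler_sum.
  by rewrite sumr_const_nat mulr_natl.
rewrite /block_mean; have [->|bK0] := eqVneq (b K) 0%N.
  by rewrite invr0 mul0r.
by rewrite ler_pdivrMl// ltr0n lt0n.
Qed.

Lemma block_mean_squeeze (R : realType) b (v : nat -> nat -> R[i])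
    (w : nat -> R) :
  (forall K, block_mean b v K <= w K) -> w @ \oo --> (0 : R) ->
  block_mean b v @ \oo --> (0 : R).
Proof.
move=> vw w0; apply: (@squeeze_cvgr _ _ _ _ (fun=> 0) w) => //.
  by apply: nearW => K; rewrite block_mean_ge0 vw.
exact: cvg_cst.
Qed.

Lemma real_momoD (R : realType) (Z : Type) (T : Z -> Z) (u : nat -> R[i])
    (f g : Z -> R) :
  real_momo T u f -> real_momo T u g -> real_momo T u (fun z => f z + g z).
Proof.
move=> mf mg b bg x.
apply: (@block_mean_squeeze _ _ _ (fun K =>
  block_mean b (fun k n => (f (iter (n - b k) T (x k)))%:C%C * u n) K +
  block_mean b (fun k n => (g (iter (n - b k) T (x k)))%:C%C * u n) K)).
  move=> K; apply: le_trans (block_meanD _ _ _ _).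
  rewrite le_eqVlt; apply/orP; left; apply/eqP; congr (block_mean b _ K).
  by apply/funext => k; apply/funext => n; rewrite (rmorphD (real_complex R)) mulrDl.
by rewrite -[X in _ --> X]addr0; apply: cvgD; [exact: mf|exact: mg].
Qed.

Lemma real_momoZ (R : realType) (Z : Type) (T : Z -> Z) (u : nat -> R[i])
    (c : R) (f : Z -> R) :
  real_momo T u f -> real_momo T u (fun z => c * f z).
Proof.
move=> mf b bg x.
apply: (@block_mean_squeeze _ _ _ (fun K => normc c%:C%C *
  block_mean b (fun k n => (f (iter (n - b k) T (x k)))%:C%C * u n) K)).
  move=> K; rewrite -block_meanZ.
  rewrite le_eqVlt; apply/orP; left; apply/eqP; congr (block_mean b _ K).
  by apply/funext => k; apply/funext => n; rewrite (rmorphM (real_complex R)) mulrA.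
rewrite -[X in _ --> X](mulr0 (normc c%:C%C)); apply: cvgM; last exact: mf.
exact: cvg_cst.
Qed.

Lemma real_momo0 (R : realType) (Z : Type) (T : Z -> Z) (u : nat -> R[i]) :
  real_momo T u (fun=> 0).
Proof.
move=> b bg x; apply: (@block_mean_squeeze _ _ _ (fun=> 0)); last exact: cvg_cst.
by move=> K; apply: block_mean_le => // k n; rewrite mul0r normc0.
Qed.

Lemma real_momo_sum (R : realType) (Z : Type) (T : Z -> Z) (u : nat -> R[i])
    (I : Type) (s : seq I) (f : I -> Z -> R) :
  (forall i, real_momo T u (f i)) ->
  real_momo T u (fun z => \sum_(i <- s) f i z).
Proof.
move=> mf; elim: s => [|i s IH].
  by under eq_fun do rewrite big_nil; exact: real_momo0.
by under eq_fun do rewrite big_cons; exact: (real_momoD (mf i) IH).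
Qed.

(** As [u] is bounded, a uniform error [d] in the observable changes every block mean by at most
    [M * d], whatever [K] and the orbits. Dividing by [M + 1] covers [M = 0]. *)
Lemma real_momo_approx (R : realType) (Z : Type) (T : Z -> Z) (u : nat -> R[i])
    (M : R) (f : Z -> R) : (forall n, normc (u n) <= M) ->
  (forall e, 0 < e -> exists2 g, real_momo T u g & forall z, `|f z - g z| <= e) ->
  real_momo T u f.
Proof.
move=> uM fg b bg x; apply/cvgr0Pnorm_le => e e0.
have M0 : 0 <= M := le_trans (normc_ge0 _) (uM 0%N).
have M1 : 0 < M + 1 by rewrite ltr_wpDl.
have e2 : 0 < e / 2 by rewrite divr_gt0.
have d0 : 0 < e / 2 / (M + 1) by rewrite divr_gt0.
have [g mg fgd] := fg _ d0.
have /cvgr0Pnorm_le/(_ _ e2) near_g := mg b bg x.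
near=> K.
have gK : `|block_mean b (fun k n => (g (iter (n - b k) T (x k)))%:C%C * u n) K|
  <= e / 2 by near: K.
rewrite ger0_norm ?block_mean_ge0//; rewrite ger0_norm ?block_mean_ge0// in gK.
have -> : (fun k n => (f (iter (n - b k) T (x k)))%:C%C * u n) =
    (fun k n => (f (iter (n - b k) T (x k)) - g (iter (n - b k) T (x k)))%:C%C * u n +
      (g (iter (n - b k) T (x k)))%:C%C * u n).
  apply/funext => k; apply/funext => n.
  by rewrite -mulrDl -(rmorphD (real_complex R)) subrK.
apply: le_trans (block_meanD _ _ _ _) _; rewrite [leRHS]splitr; apply: lerD => //.
apply: block_mean_le => // k n; rewrite normcM normc_real.
apply: (@le_trans _ _ (e / 2 / (M + 1) * (M + 1))); last by rewrite divfK// gt_eqF.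
apply: ler_pM; rewrite ?normc_ge0//.
by apply: le_trans (uM n) _; rewrite lerDl.
Unshelve. all: by end_near. Qed.

Lemma strong_MOMO_of_real (R : realType) (Z : topologicalType) (T : Z -> Z)
    (u : nat -> R[i]) :
  (forall f : Z -> R, continuous f -> real_momo T u f) -> strong_MOMO T u.
Proof.
move=> mR b bg x f cf.
have m1 := mR _ (continuous_Re cf) b bg x.
have m2 := mR _ (continuous_Im cf) b bg x.
apply: (@block_mean_squeeze _ _ _ (fun K =>
  block_mean b (fun k n => (complex.Re (f (iter (n - b k) T (x k))))%:C%C * u n) K +
  normc ('i%C : R[i]) *
  block_mean b (fun k n => (complex.Im (f (iter (n - b k) T (x k))))%:C%C * u n) K)).
  move=> K; rewrite -block_meanZ; apply: le_trans (block_meanD _ _ _ _).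
  rewrite le_eqVlt; apply/orP; left; apply/eqP; congr (block_mean b _ K).
  apply/funext => k; apply/funext => n.
  by rewrite {1}[f (iter _ _ _)]complexE mulrDl mulrA.
rewrite -[X in _ --> X]addr0; apply: cvgD => //.
rewrite -[X in _ --> X](mulr0 (normc ('i%C : R[i]))); apply: cvgM => //.
exact: cvg_cst.
Qed.

(** The factors on [X] are the sections of [F] at points [i] of [Y]. This requires [F (x, y)] to be
    close to [F (x, i)] for all [x] at once when [y] is near [i], which is the tube lemma for the
    compact space [X]. *)
Lemma tensor_approximation (R : realType) (X : topologicalType)
    (Y : ptopologicalType) (F : X * Y -> R) (e : R) :
  compact [set: X] -> compact [set: Y] -> cozero_opens R Y -> continuous F ->
  0 < e ->
  exists (s : seq Y) (g : Y -> Y -> R), (forall i, continuous (g i)) /\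
    forall x y, `|F (x, y) - \sum_(i <- s) F (x, i) * g i y| <= e.
Proof.
move=> cX cY zY cF e0.
have e2 : 0 < e / 2 by rewrite divr_gt0.
have tube y0 : \forall y \near y0, forall x, `|F (x, y) - F (x, y0)| <= e.
  have : \forall y \near y0, [set: X] `<=`
      (fun x => `|F (x, y) - F (x, y0)| <= e).
    move/compact_near_coveringP : cX; apply => x _.
    have /cvgrPdist_lt/(_ _ e2) [[A B] /= [Ax By] AB] := cF (x, y0).
    exists (A, B) => //= -[x' y] /= [Ax' By'].
    have h1 := AB (x', y) (conj Ax' By').
    have h2 := AB (x', y0) (conj Ax' (nbhs_singleton By)).
    rewrite /= distrC in h1; rewrite /= in h2.
    have := ler_normD (F (x', y) - F (x, y0)) (F (x, y0) - F (x', y0)).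
    rewrite addrA subrK /= => /le_trans; apply; rewrite [leRHS]splitr.
    by apply: lerD; exact: ltW.
  by apply: filterS => y h x; exact: h.
have /choice[phi phiP] (y0 : Y) : exists phi : Y -> R, [/\ continuous phi,
    forall y, 0 <= phi y, 0 < phi y0 &
    forall x y, 0 < phi y -> `|F (x, y) - F (x, y0)| <= e].
  pose A := [set y | forall x, `|F (x, y) - F (x, y0)| <= e].
  pose V := interior A; have oV : open V by exact: open_interior.
  have Vy0 : V y0 by exact: tube.
  have Vtube : V `<=` A by exact: interior_subset.
  have [phi [cphi phi0 VE]] := zY _ oV.
  exists phi; split => //; first by move: Vy0; rewrite VE.
  by move=> x y phiy; apply: Vtube; rewrite VE.
have cphi i : continuous (phi i) by case: (phiP i).
have phi0 i y : 0 <= phi i y by case: (phiP i).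
have := cY; rewrite compact_cover => /(_ Y setT (fun y0 => [set y | 0 < phi y0 y])).
case.
- move=> y0 _; have -> : [set y | 0 < phi y0 y] = phi y0 @^-1` [set r | 0 < r] by [].
  by apply: open_comp; [move=> y _; exact: cphi|exact: open_gt].
- by move=> y _; exists y => //=; case: (phiP y).
move=> S _ covS; pose s : seq Y := finmap.enum_fset S; exists s.
pose t y := \sum_(i <- s) phi i y.
have t0 y : 0 < t y.
  have [i /= iS phiy] := covS y I.
  rewrite /t (big_rem i)//= ltr_pwDl// sumr_ge0// => j _; exact: phi0.
have ct : continuous t.
  rewrite /t; elim: (s) => [|i s' IH].
    by under eq_fun do rewrite big_nil; exact: cst_continuous.
  under eq_fun do rewrite big_cons.
  by move=> y; apply: continuousD; [exact: cphi|exact: IH].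
exists (fun i y => phi i y * (t y)^-1); split.
  move=> i; apply: continuous_product => // y.
  by apply: continuousV; [rewrite gt_eqF|exact: ct].
move=> x y.
have -> : F (x, y) - \sum_(i <- s) F (x, i) * (phi i y * (t y)^-1) =
    \sum_(i <- s) (F (x, y) - F (x, i)) * (phi i y * (t y)^-1).
  under [RHS]eq_bigr do rewrite mulrBl.
  rewrite sumrB -[X in _ = X - _]mulr_sumr -mulr_suml -/(t y).
  by rewrite mulfV ?mulr1// gt_eqF.
apply: le_trans (ler_norm_sum _ _ _) _.
apply: (@le_trans _ _ (\sum_(i <- s) e * (phi i y * (t y)^-1))); last first.
  by rewrite -mulr_sumr -mulr_suml -/(t y) mulfV ?mulr1// gt_eqF.
(* Closeness of [F (x, y)] to [F (x, i)] is known only where [phi i y > 0]; elsewhere the weight is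
   zero. *)
apply: ler_sum => i _; have [phiy|phiy] := ltP 0 (phi i y); last first.
  have -> : phi i y = 0 by apply/eqP; rewrite eq_le phi0 phiy.
  by rewrite mul0r !mulr0 normr0.
have w0 : 0 <= phi i y * (t y)^-1 by rewrite mulr_ge0// invr_ge0 ltW.
rewrite normrM (ger0_norm w0); apply: ler_wpM2r => //.
by case: (phiP i) => _ _ _; exact.
Qed.

Lemma iter_skew_product_fst (X Y : Type) (T : X -> X) (S : X -> Y -> Y) n p :
  (iter n (skew_product T S) p).1 = iter n T p.1.
Proof. by elim: n => //= n ->. Qed.

Lemma continuous_prod_map (X Y : topologicalType) (f : X -> X) (g : Y -> Y) :
  continuous f -> continuous g -> continuous (prod_map f g : X * Y -> X * Y).
Proof.
by move=> cf cg; apply: continuous_pair; apply: continuous_compose => //;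
  [exact: continuous_fst|exact: continuous_snd].
Qed.

Theorem theorem25 (R : realType) (u : nat -> R[i])
    (u0 : u 0%N = 0)
    (umult : multiplicative_function u)
    (ubounded : exists M : R, forall n : nat, normc (u n) <= M)
    (ublock : forall b : nat -> nat, gap_sequence b ->
       block_mean b (fun _ n => u n) @ \oo --> (0 : R))
    (X Y : pmetricType R)
    (Xcompact : compact [set: X]) (Ycompact : compact [set: Y])
    (T : X -> X) (Tcont : continuous T)
    (muX : probability (borel X) R)
    (TUE : unique_invariant_measure T muX)
    (TMOMO : strong_MOMO T u)
    (S : X -> Y -> Y)
    (TScont : continuous (skew_product T S : X * Y -> X * Y))
    (muY : probability (borel Y) R)
    (TSUE : exists2 lam : probability (borel (X * Y)%type) R,
       unique_invariant_measure (skew_product T S) lam &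
       is_product_measure lam muX muY)
    (joinings : exists N : nat, forall r s : nat,
       prime r -> prime s -> (N <= r)%N -> (N <= s)%N -> r <> s ->
       forall lam : probability (borel ((X * Y) * (X * Y))%type) R,
         ergodic_measure
           (prod_map (iter r (skew_product T S)) (iter s (skew_product T S)))
           lam ->
         exists2 rho : probability (borel (X * X)%type) R,
           invariant_measure (prod_map (iter r T) (iter s T)) rho &
           is_permuted_product lam rho muY) :
  strong_MOMO (skew_product T S : X * Y -> X * Y) u.
Proof.
have [M uM] := ubounded; have [N HN] := joinings.
pose Tb : X * Y -> X * Y := skew_product T S.
have cXY : compact [set: (X * Y)%type].
  by rewrite -setXTT; exact: compact_setX.
have cZ : compact [set: ((X * Y) * (X * Y))%type].
  by rewrite -setXTT; exact: compact_setX.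
have centered (f : X -> R) (g : Y -> R) : continuous f -> continuous g ->
    (forall x, `|f x| <= 1) -> (forall y, `|g y| <= 1) ->
    \int[muY]_y g y = 0 -> real_momo Tb u (fun p => f p.1 * g p.2).
  move=> cf cg f1 g1 g0.
  have cF : continuous (fun p : X * Y => f p.1 * g p.2).
    by apply: continuous_product; apply: continuous_compose => //;
      [exact: continuous_fst|exact: continuous_snd].
  apply: (block_mean_cvg0_of_correlations (M := M) (N0 := N) umult uM).
    by move=> p; rewrite normrM mulr_ile1.
  move=> r s pr ps Nr Ns rs e e0.
  apply: (@uniform_ergodic_average R ((X * Y) * (X * Y))%type
    (prod_map (iter r Tb) (iter s Tb))
    (fun z => f z.1.1 * g z.1.2 * (f z.2.1 * g z.2.2)) cZ) => //.
  - exact: pseudometric_cozero_opens.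
  - by apply: continuous_prod_map; apply: continuous_iter.
  - by apply: continuous_product;
      [exact: (continuous_compose (@continuous_fst _ _) cF)
      |exact: (continuous_compose (@continuous_snd _ _) cF)].
  move=> lam /(HN r s pr ps Nr Ns rs)[rho _ lamP].
  exact: (permuted_product_integral0 Xcompact Ycompact lamP).
have base (f : X -> R) : continuous f -> real_momo Tb u (fun p => f p.1).
  move=> cf b bg p.
  have -> : (fun k n => (f (iter (n - b k) Tb (p k)).1)%:C%C * u n) =
      (fun k n => (f (iter (n - b k) T (p k).1))%:C%C * u n).
    by apply/funext => k; apply/funext => n; rewrite iter_skew_product_fst.
  exact: TMOMO (continuous_real_complex cf).
have tensor (f : X -> R) (g : Y -> R) : continuous f -> continuous g ->
    real_momo Tb u (fun p => f p.1 * g p.2).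
  (* With [c] the mean of [g], the product is [A * B] times a centered product of modulus at most 1,
     plus [c * f]. Dividing by the bounds [A] and [B] meets the normalisation required by
     [centered]. *)
  move=> cf cg; pose c := \int[muY]_y g y.
  have cg0 : continuous (fun y => g y + - c) by exact: continuous_sum_cst.
  have [A A0 fA] := compact_continuous_bounded Xcompact cf.
  have [B B0 gB] := compact_continuous_bounded Ycompact cg0.
  have int0 : \int[muY]_y (B^-1 * (g y + - c)) = 0.
    have muT : fine (muY setT) = 1 by rewrite (@probability_setT _ _ _ muY).
    have ig := continuous_integrable muY Ycompact cg.
    have ig0 := continuous_integrable muY Ycompact cg0.
    rewrite RintegralZl// RintegralD//; last first.
      exact: (continuous_integrable muY Ycompact (@cst_continuous _ _ (- c))).
    rewrite Rintegral_cst// muT mulr1.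
    by rewrite -/c subrr mulr0.
  have m1 : real_momo Tb u (fun p => A^-1 * f p.1 * (B^-1 * (g p.2 + - c))).
    apply: (centered (fun x => A^-1 * f x) (fun y => B^-1 * (g y + - c))) => //.
    - exact: continuous_scale.
    - exact: continuous_scale.
    - move=> x; rewrite normrM ger0_norm ?invr_ge0 ?(ltW A0)//.
      by rewrite ler_pdivrMl// mulr1.
    - move=> y; rewrite normrM ger0_norm ?invr_ge0 ?(ltW B0)//.
      by rewrite ler_pdivrMl// mulr1.
  have := real_momoD (real_momoZ (A * B) m1) (real_momoZ c (base _ cf)).
  congr (real_momo _ _ _); apply/funext => p; field.
  by rewrite !gt_eqF.
apply: strong_MOMO_of_real => F cF.
apply: (real_momo_approx uM) => e e0.
have [s [g [cg Fg]]] := tensor_approximation Xcompact Ycompact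
  (@pseudometric_cozero_opens R Y) cF e0.
exists (fun p => \sum_(i <- s) F (p.1, i) * g i p.2); last by case.
apply: real_momo_sum => i.
apply: (tensor (fun x => F (x, i)) (g i)); last exact: cg.
apply: (@continuous_compose _ _ _ (fun x => (x, i)) F) => //.
by apply: continuous_pair; [move=> x; exact: cvg_id|exact: cst_continuous].
Qed.
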